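(* Assume the standing setup (with $\mathbf{u}(x,t)\in K$ for all $(x,t)\in\Omega$) and let $\bar d(x,t)=d(\mathbf{u}(x,t))$. Then there exist functions $\alpha_{ij},\beta_i,\gamma:\Omega\to\mathbb{R}$ ($1\le i,j\le n$), each locally bounded in $\Omega$, with $\gamma\ge 0$ in $\Omega$ and the matrix $\{\alpha_{ij}(x,t)\}$ locally uniformly positive definite in $\Omega$, such that $\bar d$ is a viscosity supersolution of $$\frac{\partial \bar d}{\partial t}-\sum_{i,j}\alpha_{ij}(x,t)\frac{\partial^2\bar d}{\partial x_i\partial x_j}-\sum_i\beta_i(x,t)\frac{\partial\bar d}{\partial x_i}+\gamma(x,t)\bar d\ge 0,$$ in the following sense: whenever $(\hat x,\hat t)\in\Omega$ and $\psi\in C^\infty(\Omega)$ satisfy $\psi(\hat x,\hat t)=\bar d(\hat x,\hat t)$ and $\psi\le\bar d$ in a neighborhood of $(\hat x,\hat t)$, we have $$\psi_t-\sum_{i,j}\alpha_{ij}\psi_{x_ix_j}-\sum_i\beta_i\psi_{x_i}+\gamma\psi\ge 0\quad\text{at }(\hat x,\hat t).$$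
   Context: Standing setup: $X\subseteq\mathbb{R}^n$ is open and connected, $\Omega=X\times(0,\infty)$, and $\mathbf{u}\in C^{2,1}(\Omega;\mathbb{R}^k)\cap C(\bar\Omega;\mathbb{R}^k)$ solves $$\frac{\partial\mathbf{u}}{\partial t}=D(x,t,\mathbf{u})\sum_{i,j}a_{ij}(x,t)\frac{\partial^2\mathbf{u}}{\partial x_i\partial x_j}+\sum_i M_i(x,t,\mathbf{u})\frac{\partial\mathbf{u}}{\partial x_i}+\phi(x,t,\mathbf{u})$$ in $\Omega$, where $a_{ij}$ are real-valued, $\phi$ is $\mathbb{R}^k$-valued, and $D(x,t,z)$, $M_i(x,t,z)$ are $k\times k$ real matrices. Assumptions: $\phi,D,M_i$ are Lipschitz in $z$ uniformly for $(x,t)$ in compact subsets of $\Omega$; each $a_{ij}$ is locally bounded in $\Omega$; $D$ and each $M_i$ are locally bounded in $\Omega\times\mathbb{R}^k$; $\{a_{ij}(x,t)\}$ is symmetric and locally uniformly positive definite in $\Omega$; $D(x,t,z)$ is locally uniformly positive definite in $\Omega\times\mathbb{R}^k$. $K\subseteq\mathbb{R}^k$ is a closed convex set with $K\ne\mathbb{R}^k$, compatible with $\phi,D,M_i$: for all $(x,t)\in\Omega$, all $v\in\partial K$ and every vector $\nu$ inward pointing at $v$, $\phi(x,t,v)\cdot\nu\ge0$ and $\nu$ is a left eigenvector of $D(x,t,v)$ and of each $M_i(x,t,v)$. Definitions: for $v\in\partial K$, a supporting affine functional of $K$ at $v$ is an affine $\ell:K\to\mathbb{R}$ with $\ell\ge0$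 on $K$, $\ell(v)=0$, $|\nabla\ell|=1$. A vector $\nu$ is inward pointing at $v\in\partial K$ if $\nu=\nabla\ell$ for some supporting affine functional $\ell$ of $K$ at $v$. For $z\in K$, $d(z)=\inf\{|z-v|:v\in\partial K\}$. *)

(* Defs.v *)
From Stdlib Require Import Reals ClassicalEpsilon.
From mathcomp Require Import ssreflect ssrfun ssrbool eqtype ssrnat seq fintype bigop.
Set Implicit Arguments. Unset Strict Implicit.
Open Scope R_scope.

Definition vec (n : nat) := 'I_n -> R.
Definition vsum (n : nat) (F : 'I_n -> R) : R := \big[Rplus/0]_(i < n) F i.
Definition dot (n : nat) (u v : vec n) : R := vsum (fun i => u i * v i).
Definition vnorm (n : nat) (v : vec n) : R := sqrt (dot v v).
Definition vsub (n : nat) (u v : vec n) : vec n := fun i => u i - v i.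
Definition vdist (n : nat) (u v : vec n) : R := vnorm (vsub u v).
Definition vzero (n : nat) : vec n := fun _ => 0.
Definition upd (n : nat) (x : vec n) (i : 'I_n) (s : R) : vec n :=
  fun j => if j == i then x j + s else x j.

Definition open_set_n (n : nat) (X : vec n -> Prop) : Prop :=
  forall x, X x -> exists r, 0 < r /\ forall y, vdist y x < r -> X y.
Definition connected_n (n : nat) (X : vec n -> Prop) : Prop :=
  forall U V : vec n -> Prop, open_set_n U -> open_set_n V ->
    (forall x, X x <-> (U x \/ V x)) -> (forall x, ~ (U x /\ V x)) ->
    (forall x, ~ U x) \/ (forall x, ~ V x).
Definition closed_set_n (k : nat) (K : vec k -> Prop) : Prop :=
  forall z, (forall eps, 0 < eps -> exists w, K w /\ vdist z w < eps) -> K z.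
Definition convex_n (k : nat) (K : vec k -> Prop) : Prop :=
  forall z w l, K z -> K w -> 0 <= l <= 1 -> K (fun a => l * z a + (1 - l) * w a).
Definition boundary_n (k : nat) (K : vec k -> Prop) (v : vec k) : Prop :=
  (forall eps, 0 < eps -> exists w, K w /\ vdist v w < eps) /\
  (forall eps, 0 < eps -> exists w, ~ K w /\ vdist v w < eps).

Definition supporting_affine (k : nat) (K : vec k -> Prop) (v nu : vec k) (c : R) : Prop :=
  (forall z, K z -> 0 <= dot nu z + c) /\ dot nu v + c = 0 /\ vnorm nu = 1.
Definition inward_pointing (k : nat) (K : vec k -> Prop) (v nu : vec k) : Prop :=
  boundary_n K v /\ exists c, supporting_affine K v nu c.

Definition left_eigvec (k : nat) (A : 'I_k -> 'I_k -> R) (nu : vec k) : Prop :=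
  (exists a, nu a <> 0) /\
  exists lam, forall b, vsum (fun a => nu a * A a b) = lam * nu b.

Definition is_glb_n (S : R -> Prop) (m : R) : Prop :=
  (forall r, S r -> m <= r) /\ (forall m', (forall r, S r -> m' <= r) -> m' <= m).
Definition dist_bdry (k : nat) (K : vec k -> Prop) (z : vec k) : R :=
  epsilon (inhabits 0)
    (fun m => is_glb_n (fun r => exists v, boundary_n K v /\ r = vdist z v) m).

Definition pdist (n : nat) (x : vec n) (t : R) (y : vec n) (s : R) : R :=
  sqrt (vdist x y ^ 2 + (t - s) ^ 2).
Definition Omega (n : nat) (X : vec n -> Prop) (x : vec n) (t : R) : Prop :=
  X x /\ 0 < t.
Definition closure_st (n : nat) (S : vec n -> R -> Prop) (x : vec n) (t : R) : Prop :=
  forall eps, 0 < eps -> exists y s, S y s /\ pdist x t y s < eps.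
Definition compact_in (n : nat) (C S : vec n -> R -> Prop) : Prop :=
  (forall x t, closure_st C x t -> C x t) /\
  (exists B, forall x t, C x t -> pdist x t (@vzero n) 0 <= B) /\
  (forall x t, C x t -> S x t).

Definition cont_on (n : nat) (S : vec n -> R -> Prop) (f : vec n -> R -> R) : Prop :=
  forall x t, S x t -> forall eps, 0 < eps -> exists del, 0 < del /\
    forall y s, S y s -> pdist x t y s < del -> Rabs (f y s - f x t) < eps.

Definition pderiv_t (n : nat) (S : vec n -> R -> Prop) (f g : vec n -> R -> R) : Prop :=
  forall x t, S x t -> derivable_pt_lim (fun s => f x s) t (g x t).
Definition pderiv_x (n : nat) (S : vec n -> R -> Prop) (f : vec n -> R -> R)
  (i : 'I_n) (g : vec n -> R -> R) : Prop :=
  forall x t, S x t -> derivable_pt_lim (fun s => f (upd x i s) t) 0 (g x t).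

Fixpoint Ck (n : nat) (Sd : vec n -> R -> Prop) (m : nat) (f : vec n -> R -> R) : Prop :=
  match m with
  | O => cont_on Sd f
  | Datatypes.S m' => cont_on Sd f /\
      (exists g, pderiv_t Sd f g /\ Ck Sd m' g) /\
      (forall i, exists g, pderiv_x Sd f i g /\ Ck Sd m' g)
  end.
Definition smooth_n (n : nat) (S : vec n -> R -> Prop) (f : vec n -> R -> R) : Prop :=
  forall m, Ck S m f.

Definition loc_bounded (n : nat) (S : vec n -> R -> Prop) (f : vec n -> R -> R) : Prop :=
  forall C, compact_in C S -> exists B, forall x t, C x t -> Rabs (f x t) <= B.
Definition loc_bounded_z (n k : nat) (S : vec n -> R -> Prop)
  (F : vec n -> R -> vec k -> R) : Prop :=
  forall C, compact_in C S -> forall Rad, exists B,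
    forall x t z, C x t -> vnorm z <= Rad -> Rabs (F x t z) <= B.
Definition lipschitz_z (n k : nat) (S : vec n -> R -> Prop)
  (F : vec n -> R -> vec k -> R) : Prop :=
  forall C, compact_in C S -> exists L, forall x t z w, C x t ->
    Rabs (F x t z - F x t w) <= L * vdist z w.
Definition quad_n (n : nat) (A : 'I_n -> 'I_n -> R) (xi : vec n) : R :=
  vsum (fun i => vsum (fun j => A i j * xi i * xi j)).
Definition loc_unif_posdef (n : nat) (S : vec n -> R -> Prop)
  (A : 'I_n -> 'I_n -> vec n -> R -> R) : Prop :=
  forall C, compact_in C S -> exists lam, 0 < lam /\
    forall x t (xi : vec n), C x t -> quad_n (fun i j => A i j x t) xi >= lam * dot xi xi.
Definition loc_unif_posdef_z (n k : nat) (S : vec n -> R -> Prop)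
  (A : vec n -> R -> vec k -> 'I_k -> 'I_k -> R) : Prop :=
  forall C, compact_in C S -> forall Rad, exists lam, 0 < lam /\
    forall x t z (xi : vec k), C x t -> vnorm z <= Rad ->
      quad_n (A x t z) xi >= lam * dot xi xi.

(* Main.v *)
(** Fix a point of Omega, let v be a boundary point of K closest to z = u and
    nu a unit inward normal of a supporting hyperplane at v.  The affine
    function l(w) = nu . (w - v) dominates the distance d on K and agrees with
    it at z, so l(u) - psi has a local minimum: its first derivatives vanish
    and its Hessian is nonnegative.  Contracting the system with nu, and
    using that nu is a left eigenvector of D(v) and M_i(v) with eigenvalues
    lam and mu_i, gives the inequality with alpha = lam a and beta = mu; the
    errors F(z) - F(v) for F = D, M_i, phi are difference quotients times
    |z - v| = d, and those quotients make up gamma. *)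
Require Import Defs.
From Stdlib Require Import Reals Lra Classical ClassicalEpsilon FunctionalExtensionality.
From HB Require Import structures.
From mathcomp Require Import ssreflect ssrfun ssrbool eqtype ssrnat seq fintype bigop.
Set Implicit Arguments.
Unset Strict Implicit.
Open Scope R_scope.

(** The distance to the boundary need not be differentiable, and neither the nearest point nor the
    normal there need be unique or depend continuously on [u]. The pair [(v, nu)] is therefore
    selected by choice from the value of [u], and only bounds on it are ever used; at a touching
    point it is frozen, so every derivative falls on [u] itself. Any supporting normal at the
    nearest point will do. The direction [z - v] is avoided because it vanishes when [z] lies on the
    boundary. The eigenvalues are written as the quadratic forms of D(v) and M_i(v) at the unit
    vector nu. This makes their local bounds, and the positivity of lam, direct consequences of the
    hypotheses on D and M_i. The vector nu need not be a left eigenvector of D(z) - D(v) or M_i(z) -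
    M_i(v), so these errors, applied to derivatives of [u], cannot be expressed through derivatives
    of psi. They are bounded entrywise in absolute value, which makes gamma nonnegative and
    dependent on the solution; gamma is locally bounded because [u] is of class C^{2,1}. *)

HB.instance Definition _ := Monoid.isComLaw.Build R 0 Rplus
  (fun x y z => esym (Rplus_assoc x y z)) Rplus_comm Rplus_0_l.

(** * Finite sums of reals *)

Lemma eq_vsum n (F G : 'I_n -> R) : (forall i, F i = G i) -> vsum F = vsum G.
Proof. by move=> FG; apply: eq_bigr => i _. Qed.

Lemma vsum_recl n (F : 'I_n.+1 -> R) :
  vsum F = F ord0 + vsum (fun i : 'I_n => F (lift ord0 i)).
Proof. exact: big_ord_recl. Qed.

(** Serves the inductions on the dimension; with a time as [s] it also packs a point of space-time
    into a single vector. *)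
Definition vcons n (s : R) (q : vec n) : vec n.+1 :=
  fun i => oapp q s (unlift ord0 i).

Lemma vcons0 n s (q : vec n) : vcons s q ord0 = s.
Proof. by rewrite /vcons unlift_none. Qed.

Lemma vconsS n s (q : vec n) i : vcons s q (lift ord0 i) = q i.
Proof. by rewrite /vcons liftK. Qed.

Lemma vsumD n (F G : 'I_n -> R) : vsum (fun i => F i + G i) = vsum F + vsum G.
Proof. exact: big_split. Qed.

Lemma vsumZ n c (F : 'I_n -> R) : vsum (fun i => c * F i) = c * vsum F.
Proof.
rewrite /vsum (big_morph (Rmult c) (id1 := 0) (op1 := Rplus)) //; last lra.
by move=> x y; rewrite Rmult_plus_distr_l.
Qed.

Lemma vsumZr n c (F : 'I_n -> R) : vsum (fun i => F i * c) = vsum F * c.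
Proof. by rewrite Rmult_comm -vsumZ; apply: eq_vsum => i; lra. Qed.

Lemma vsumB n (F G : 'I_n -> R) : vsum (fun i => F i - G i) = vsum F - vsum G.
Proof.
rewrite (_ : vsum F - vsum G = vsum F + -1 * vsum G); last lra.
by rewrite -vsumZ -vsumD; apply: eq_vsum => i; lra.
Qed.

Lemma vsum_telescope n (f : nat -> R) :
  vsum (fun i : 'I_n => f i.+1 - f i) = f n - f O.
Proof.
elim: n => [|n IH]; first by rewrite /vsum big_ord0; lra.
rewrite /vsum big_ord_recr /=; move: IH; rewrite /vsum => ->; lra.
Qed.

Lemma vsum_exchange m n (F : 'I_m -> 'I_n -> R) :
  vsum (fun i => vsum (fun j => F i j)) = vsum (fun j => vsum (fun i => F i j)).
Proof. exact: exchange_big. Qed.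

Lemma vsum_le n (F G : 'I_n -> R) : (forall i, F i <= G i) -> vsum F <= vsum G.
Proof.
move=> FG; rewrite /vsum; elim/big_ind2: _ => [|x1 x2 y1 y2|i _]; [lra|lra|exact: FG].
Qed.

Lemma vsum_ge0 n (F : 'I_n -> R) : (forall i, 0 <= F i) -> 0 <= vsum F.
Proof. by move=> F0; rewrite /vsum; elim/big_ind: _ => [|x y|i _]; [lra|lra|exact: F0]. Qed.

Lemma vsum_const n c : vsum (fun _ : 'I_n => c) = INR n * c.
Proof.
elim: n => [|n IH]; first by rewrite /vsum big_ord0 /=; lra.
by rewrite vsum_recl IH S_INR; lra.
Qed.

Lemma Rabs_vsum n (F : 'I_n -> R) : Rabs (vsum F) <= vsum (fun i => Rabs (F i)).
Proof.
elim: n F => [|n IH] F; first by rewrite /vsum !big_ord0 Rabs_R0; lra.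
rewrite !vsum_recl; apply: Rle_trans (Rabs_triang _ _) _.
exact: Rplus_le_compat_l (IH _).
Qed.

Lemma vsum_ge_term n (F : 'I_n -> R) i : (forall j, 0 <= F j) -> F i <= vsum F.
Proof.
move=> F0; rewrite /vsum (bigD1 i) //=.
rewrite -{1}(Rplus_0_r (F i)); apply: Rplus_le_compat_l.
by elim/big_ind: _ => [|x y|j _]; [lra|lra|exact: F0].
Qed.

Lemma derivable_pt_lim_vsum n (F : 'I_n -> R -> R) (l : 'I_n -> R) s :
  (forall i, derivable_pt_lim (F i) s (l i)) ->
  derivable_pt_lim (fun h => vsum (fun i => F i h)) s (vsum l).
Proof.
elim: n F l => [|n IH] F l dF.
  rewrite (_ : (fun _ => _) = fct_cte 0); last first.
    by apply: functional_extensionality => h; rewrite /vsum big_ord0.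
  rewrite /vsum big_ord0; exact: derivable_pt_lim_const.
rewrite vsum_recl (_ : (fun h => _) = (F ord0 + (fun h => vsum (fun i => F (lift ord0 i) h)))%F).
  apply: derivable_pt_lim_plus => //; exact: IH.
by apply: functional_extensionality => h; rewrite vsum_recl.
Qed.

(** * Inner product, norm and distance *)

Lemma dotC n (u v : vec n) : dot u v = dot v u.
Proof. by apply: eq_vsum => i; lra. Qed.

Lemma dot_linl n a b (u v w : vec n) :
  dot (fun i => a * u i + b * v i) w = a * dot u w + b * dot v w.
Proof. by rewrite /dot -!vsumZ -vsumD; apply: eq_vsum => i; lra. Qed.

Lemma dot_lin_sqr n a b (u v : vec n) :
  dot (fun i => a * u i + b * v i) (fun i => a * u i + b * v i) =
  a * a * dot u u + 2 * a * b * dot u v + b * b * dot v v.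
Proof.
rewrite dot_linl (dotC u) (dotC v) !dot_linl (dotC v u); lra.
Qed.

Lemma dotBl n (u v w : vec n) : dot (vsub u v) w = dot u w - dot v w.
Proof. by rewrite /dot -vsumB; apply: eq_vsum => i; rewrite /vsub; lra. Qed.

Lemma dotBr n (u v w : vec n) : dot w (vsub u v) = dot w u - dot w v.
Proof. by rewrite dotC dotBl !(dotC w). Qed.

Lemma dotZl n a (u w : vec n) : dot (fun i => a * u i) w = a * dot u w.
Proof. by rewrite /dot -vsumZ; apply: eq_vsum => i; lra. Qed.

Lemma dot_ge0 n (v : vec n) : 0 <= dot v v.
Proof. by apply: vsum_ge0 => i; nra. Qed.

Lemma sq_le_dot n (v : vec n) i : v i * v i <= dot v v.
Proof. by apply: (@vsum_ge_term _ (fun i => v i * v i)) => j; nra. Qed.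

Lemma vnorm_ge0 n (v : vec n) : 0 <= vnorm v.
Proof. exact: sqrt_pos. Qed.

Lemma vnorm_sqr n (v : vec n) : vnorm v * vnorm v = dot v v.
Proof. by apply: sqrt_sqrt; exact: dot_ge0. Qed.

Lemma coord_le_vnorm n (v : vec n) i : Rabs (v i) <= vnorm v.
Proof.
rewrite -(sqrt_Rsqr_abs (v i)); apply: sqrt_le_1_alt; exact: sq_le_dot.
Qed.

Lemma vnorm_mono n (u v : vec n) :
  (forall i, Rabs (u i) <= Rabs (v i)) -> vnorm u <= vnorm v.
Proof.
by move=> uv; apply: sqrt_le_1_alt; apply: vsum_le => i; apply: Rsqr_le_abs_1.
Qed.

Lemma vnorm_le_coord n (v : vec n) e :
  (forall i, Rabs (v i) <= e) -> 0 <= e -> vnorm v <= (INR n + 1) * e.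
Proof.
move=> ve e0; have n0 := pos_INR n.
rewrite -(sqrt_square ((INR n + 1) * e)); last by nra.
apply: sqrt_le_1_alt; apply: (Rle_trans _ (INR n * (e * e))); last by nra.
rewrite -vsum_const; apply: vsum_le => i.
by have := ve i; rewrite /Rabs; case: Rcase_abs; nra.
Qed.

(** Cauchy-Schwarz, from the nonnegative square of [(v.v) u - (u.v) v], which equals [v.v] times the
    difference of the two sides. *)
Lemma dot_sqr_le n (u v : vec n) : dot u v * dot u v <= dot u u * dot v v.
Proof.
have [v0|vp] : dot v v = 0 \/ 0 < dot v v by have := dot_ge0 v; lra.
  suff -> : dot u v = 0 by have := dot_ge0 u; nra.
  rewrite /dot (@eq_vsum _ _ (fun _ => 0)) ?vsum_const; first lra.
  by move=> i; have := sq_le_dot v i; rewrite v0 => ?; have -> : v i = 0 by [nra]; lra.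
have := dot_ge0 (fun i => dot v v * u i + (- dot u v) * v i).
rewrite dot_lin_sqr; nra.
Qed.

Lemma dot_le_vnorm n (u v : vec n) : dot u v <= vnorm u * vnorm v.
Proof.
have := dot_sqr_le u v; rewrite -!vnorm_sqr.
have := vnorm_ge0 u; have := vnorm_ge0 v; move: (vnorm u) (vnorm v) => a b.
move=> b0 a0 H; apply: Rnot_lt_le => L.
have ab0 := Rmult_le_pos _ _ a0 b0.
have := Rmult_le_0_lt_compat _ _ _ _ ab0 ab0 L L; nra.
Qed.

Lemma vdistC n (u v : vec n) : vdist u v = vdist v u.
Proof. by rewrite /vdist /vnorm; congr sqrt; apply: eq_vsum => i; rewrite /vsub; lra. Qed.

Lemma vdist_ge0 n (u v : vec n) : 0 <= vdist u v.
Proof. exact: vnorm_ge0. Qed.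

Lemma vdist_triang n (u v w : vec n) : vdist u w <= vdist u v + vdist v w.
Proof.
have a0 := vdist_ge0 u v; have b0 := vdist_ge0 v w.
rewrite -(sqrt_square (vdist u v + vdist v w)); last lra.
apply: sqrt_le_1_alt.
have -> : vsub u w = fun i => 1 * vsub u v i + 1 * vsub v w i.
  by apply: functional_extensionality => i; rewrite /vsub; lra.
rewrite dot_lin_sqr.
have := dot_le_vnorm (vsub u v) (vsub v w); rewrite -!vnorm_sqr -/(vdist u v) -/(vdist v w); nra.
Qed.

Lemma vdistxx n (u : vec n) : vdist u u = 0.
Proof.
rewrite /vdist /vnorm (_ : dot _ _ = 0) ?sqrt_0 //.
rewrite /dot (@eq_vsum _ _ (fun _ => 0)) ?vsum_const; first lra.
by move=> i; rewrite /vsub; lra.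
Qed.

Lemma vdist_eq0 n (u v : vec n) : vdist u v = 0 -> u = v.
Proof.
move=> d0; apply: functional_extensionality => i.
have := coord_le_vnorm (vsub u v) i; rewrite -/(vdist u v) d0 /vsub.
by rewrite /Rabs; case: Rcase_abs; lra.
Qed.

Lemma vnorm_vdist0 n (u : vec n) : vnorm u = vdist u (@vzero n).
Proof.
by rewrite /vdist; congr vnorm; apply: functional_extensionality => i; rewrite /vsub /vzero; lra.
Qed.

Lemma vnormZ n a (u : vec n) : vnorm (fun i => a * u i) = Rabs a * vnorm u.
Proof.
rewrite /vnorm dotZl dotC dotZl -Rmult_assoc sqrt_mult_alt; last by nra.
by rewrite sqrt_Rsqr_abs.
Qed.

(** * Compactness and nearest points *)

(** A tolerance [e] replaces the index of a sequence, so no subsequence has to be extracted: [P e]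
    plays the role of a tail, and the conclusion gives a cluster point. *)
Lemma bolzano_weierstrass n (P : R -> vec n -> Prop) (r : R) :
  (forall e e' q, e <= e' -> P e q -> P e' q) ->
  (forall e, 0 < e -> exists q, (forall i, Rabs (q i) <= r) /\ P e q) ->
  exists p, forall e, 0 < e -> exists q, (forall i, Rabs (q i - p i) < e) /\ P e q.
Proof.
elim: n P => [|n IH] P Pmono PE.
  exists (fun _ => 0) => e /PE [q [_ Pq]]; exists q; split=> // i.
  by case: i.
(* The supremum of [E] is the upper limit of the first coordinates as the tolerance tends to 0; it
   becomes the first coordinate of the cluster point. *)
pose E s := forall e, 0 < e -> exists q,
  (forall i, Rabs (q i) <= r) /\ P e q /\ s <= q ord0.
have [] := completeness E.
- exists r => s /(_ 1 Rlt_0_1) [q [qr [_ sq]]].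
  by have := qr ord0; have := Rle_abs (q ord0); lra.
- exists (- r) => e /PE [q [qr Pq]]; exists q; split=> //; split=> //.
  by have := qr ord0; rewrite /Rabs; case: Rcase_abs; lra.
move=> s [sub slub].
have near e : 0 < e -> exists q, (forall i, Rabs (q i) <= r) /\ P e q /\ Rabs (q ord0 - s) < e.
  move=> e0.
  have [s1 [Es1 s1s]] : exists s1, E s1 /\ s - e < s1.
    apply: NNPP => H; suff : s <= s - e by lra.
    by apply: slub => s1 Es1; apply: Rnot_lt_le => L; apply: H; exists s1.
  have [e1 [e10 He1]] : exists e1, 0 < e1 /\
      forall q, (forall i, Rabs (q i) <= r) -> P e1 q -> q ord0 < s + e / 2.
    apply: NNPP => H; suff /sub : E (s + e / 2) by lra.
    move=> e1 e10; apply: NNPP => H1; apply: H; exists e1; split=> // q qr Pq.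
    by apply: Rnot_le_lt => L; apply: H1; exists q.
  have m0 : 0 < Rmin e e1 by exact: Rmin_glb_lt.
  have [q [qr [Pq s1q]]] := Es1 _ m0.
  exists q; split=> //; split; first by apply: Pmono Pq; exact: Rmin_l.
  have := He1 q qr (Pmono _ _ _ (Rmin_r e e1) Pq).
  by rewrite /Rabs; case: Rcase_abs; lra.
(* Closeness of the first coordinate is absorbed into the predicate, so the remaining coordinates
   converge along points whose first one is already controlled. *)
have [|e e0|p Hp] := IH (fun e q => exists s0, Rabs (s0 - s) < e /\ P e (vcons s0 q)).
- by move=> e e' q ee' [s0 [s0s Pq]]; exists s0; split; [lra|exact: Pmono ee' Pq].
- have [q [qr [Pq qs]]] := near e e0.
  exists (fun i => q (lift ord0 i)); split=> [i|]; first exact: qr.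
  exists (q ord0); split=> //; congr (P e): Pq.
  apply: functional_extensionality => i; rewrite /vcons.
  by case: unliftP => [j|] ->.
exists (vcons s p) => e /Hp [q [qp [s0 [s0s Pq]]]]; exists (vcons s0 q); split=> // i.
by rewrite /vcons; case: unliftP => [j|] _ /=.
Qed.

(** A cluster point of near-minimisers lies in the closed set [S] and attains the infimum. Capping
    the tolerance at 1 keeps them bounded, whence the radius [m + vnorm z + 1]. *)
Lemma closest_point k (S : vec k -> Prop) (z : vec k) (m : R) :
  closed_set_n S -> is_glb_n (fun r => exists v, S v /\ r = vdist z v) m ->
  exists v, S v /\ vdist z v = m.
Proof.
move=> Scl [mlb mglb]; have k0 := pos_INR k.
have [||p Hp] := @bolzano_weierstrass k
    (fun e q => S q /\ vdist z q <= m + e) (m + vnorm z + 1).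
- by move=> e e' q ee' [Sq]; split=> //; lra.
- move=> e e0; have [q [Sq zq]] : exists q, S q /\ vdist z q <= m + Rmin e 1.
    apply: NNPP => H; have : 0 < Rmin e 1 by apply: Rmin_glb_lt; lra.
    suff : m + Rmin e 1 <= m by lra.
    by apply: mglb => _ [v [Sv ->]]; apply: Rlt_le; apply: Rnot_le_lt => L; apply: H; exists v.
  exists q; have := Rmin_l e 1; have := Rmin_r e 1 => *; split=> [i|]; last by split=> //; lra.
  have := coord_le_vnorm q i; rewrite (vnorm_vdist0 q) (vnorm_vdist0 z).
  by have := vdist_triang q z (@vzero k); rewrite (vdistC q z); lra.
have close e : 0 < e -> exists q, S q /\ vdist z q <= m + e /\ vdist p q < e.
  (* Coordinatewise closeness within d gives distance at most [(INR k + 1) * d]; the extra unit in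
     the denominator makes the bound strict. *)
  move=> e0; have d0 : 0 < e / (INR k + 2) by apply: Rdiv_lt_0_compat; lra.
  have E : (INR k + 2) * (e / (INR k + 2)) = e by field; lra.
  have [q [qp [Sq zq]]] := Hp _ d0; exists q; split=> //; split; first nra.
  rewrite vdistC; apply: (Rle_lt_trans _ ((INR k + 1) * (e / (INR k + 2)))); last nra.
  by apply: vnorm_le_coord => [i|]; [apply: Rlt_le; exact: qp|lra].
have Sp : S p by apply: Scl => e /close [q [Sq [_ pq]]]; exists q.
exists p; split=> //; apply: Rle_antisym; last by apply: mlb; exists p.
apply: Rnot_lt_le => L.
have [|q [_ [zq pq]]] := close ((vdist z p - m) / 2); first lra.
by have := vdist_triang z q p; rewrite (vdistC q p); lra.
Qed.

Lemma dist_glb k (S : vec k -> Prop) (z : vec k) : (exists v, S v) ->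
  exists m, is_glb_n (fun r => exists v, S v /\ r = vdist z v) m.
Proof.
move=> [v0 Sv0].
have [] := completeness (fun r => exists v, S v /\ - r = vdist z v).
- by exists 0 => r [v [_ E]]; have := vdist_ge0 z v; lra.
- by exists (- vdist z v0), v0; split=> //; lra.
move=> m [mub mlub]; exists (- m); split=> [_ [v [Sv ->]]|m' Hm'].
  suff : - vdist z v <= m by lra.
  by apply: mub; exists v; split=> //; lra.
suff : m <= - m' by lra.
apply: mlub => r [v [Sv E]].
have : m' <= - r by apply: Hm'; exists v.
lra.
Qed.

(** * Boundary points, separation and supporting functionals *)

(** The boundary point sits at the supremum of the parameters in [0,1] at which the segment from [w]
    to [y] is in [K]. *)
Lemma segment_meets_boundary k (K : vec k -> Prop) (w y : vec k) :
  K w -> ~ K y -> exists v, boundary_n K v /\ vdist w v <= vdist w y.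
Proof.
move=> Kw Ky; pose pt s : vec k := fun i => w i + s * (y i - w i).
have pt0 : pt 0 = w by apply: functional_extensionality => i; rewrite /pt; lra.
have pt1 : pt 1 = y by apply: functional_extensionality => i; rewrite /pt; lra.
have dpt s s' : vdist (pt s) (pt s') = Rabs (s - s') * vdist y w.
  rewrite /vdist -vnormZ; congr vnorm; apply: functional_extensionality => i.
  by rewrite /vsub /pt; lra.
have [] := completeness (fun s => 0 <= s <= 1 /\ K (pt s)).
- by exists 1 => s; lra.
- by exists 0; rewrite pt0; split=> //; lra.
move=> s [sub slub].
have s0 : 0 <= s by apply: sub; rewrite pt0; split=> //; lra.
have s1 : s <= 1 by apply: slub => s'; lra.
have N0 := vdist_ge0 y w.
have small e : 0 < e -> 0 < e / (vdist y w + 1) /\ e / (vdist y w + 1) * vdist y w < e.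
  move=> e0; have d0 : 0 < e / (vdist y w + 1) by apply: Rdiv_lt_0_compat; lra.
  by have E : (vdist y w + 1) * (e / (vdist y w + 1)) = e by [field; lra]; split; nra.
exists (pt s); split; last first.
  rewrite -{1}pt0 dpt (vdistC w y) Rabs_left1; nra.
split=> e /small []; move: (e / _) => d d0 dN; have dN0 := Rmult_le_pos _ _ (Rlt_le _ _ d0) N0.
- have [s' [[s'01 Ks'] s's]] : exists s', (0 <= s' <= 1 /\ K (pt s')) /\ s - d < s'.
    apply: NNPP => H; suff : s <= s - d by lra.
    by apply: slub => s' Hs'; apply: Rnot_lt_le => L; apply: H; exists s'.
  exists (pt s'); split=> //; rewrite dpt.
  have s'le := sub s' (conj s'01 Ks').
  by rewrite Rabs_pos_eq; nra.
- have [L|L] := Rlt_le_dec (s + d / 2) 1.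
    exists (pt (s + d / 2)); split.
      move=> Kp; have : s + d / 2 <= s by apply: sub; split=> //; lra.
      lra.
    by rewrite dpt Rabs_left1; nra.
  (* Here the supremum is within [d / 2] of 1, and the endpoint [y] itself is the nearby point
     outside [K]. *)
  exists y; split=> //; rewrite -pt1 dpt.
  by rewrite Rabs_left1; rewrite ?pt1; nra.
Qed.

Lemma boundary_closed k (K : vec k -> Prop) : closed_set_n (boundary_n K).
Proof.
move=> z Hz; split=> e e0; have [|v [[B1 B2] zv]] := Hz (e / 2); try lra.
- have [|w [Kw vw]] := B1 (e / 2); first lra.
  by exists w; split=> //; have := vdist_triang z v w; lra.
- have [|w [Kw vw]] := B2 (e / 2); first lra.
  by exists w; split=> //; have := vdist_triang z v w; lra.
Qed.

(** The normal is the unit vector from [y] to its nearest point [p] in [K]; minimality of [p] along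
    segments inside [K] yields the variational inequality [var]. *)
Lemma strict_separation k (K : vec k -> Prop) (y : vec k) :
  closed_set_n K -> convex_n K -> (exists w, K w) -> ~ K y ->
  exists nu, vnorm nu = 1 /\ forall w, K w -> dot nu y <= dot nu w.
Proof.
move=> Kcl Kcv Kne Ky.
have [m Hm] := dist_glb y Kne.
have [p [Kp ypm]] := closest_point Kcl Hm.
have yp : 0 < vnorm (vsub p y).
  have [//|E] : 0 < vnorm (vsub p y) \/ vdist p y = 0.
    by have := vdist_ge0 p y; rewrite /vdist; lra.
  by case: Ky; rewrite -(vdist_eq0 E).
have var w : K w -> 0 <= dot (vsub p y) (vsub w p).
  move=> Kw; set e := vsub p y; set f := vsub w p.
  apply: Rnot_lt_le => ef.
  have quad l : 0 <= l <= 1 -> dot e e <= dot e e + 2 * l * dot e f + l * l * dot f f.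
    move=> l01; have Kl := Kcv w p l Kw Kp l01.
    have : m <= vdist y (fun a => l * w a + (1 - l) * p a).
      by apply: (proj1 Hm); exists (fun a => l * w a + (1 - l) * p a).
    rewrite -ypm vdistC (vdistC y _) /vdist.
    have -> : vsub (fun a => l * w a + (1 - l) * p a) y = fun i => 1 * e i + l * f i.
      by apply: functional_extensionality => i; rewrite /e /f /vsub; lra.
    rewrite -/e => H.
    have : dot e e <= dot (fun i => 1 * e i + l * f i) (fun i => 1 * e i + l * f i).
      by rewrite -!vnorm_sqr; have := vnorm_ge0 e; nra.
    by rewrite dot_lin_sqr; lra.
  have ff := dot_ge0 f.
  (* With this [l] the increment [2 * l * (e.f) + l * l * (f.f)] equals [l * (1 + l) * (e.f)], which
     is negative. The term [- dot e f] in the denominator forces [l <= 1] and covers [f = 0]. *)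
  pose l := - dot e f / (dot f f - dot e f).
  have El : l * (dot f f - dot e f) = - dot e f by rewrite /l; field; lra.
  have l0 : 0 < l by apply: Rdiv_lt_0_compat; lra.
  have l1 : l <= 1 by nra.
  have := quad l (conj (Rlt_le _ _ l0) l1); nra.
exists (fun i => / vnorm (vsub p y) * vsub p y i); split.
  rewrite vnormZ Rabs_pos_eq; first by field; lra.
  by apply: Rlt_le; apply: Rinv_0_lt_compat.
move=> w /var H; rewrite !dotZl.
apply: Rmult_le_compat_l; first by apply: Rlt_le; apply: Rinv_0_lt_compat.
move: H (dot_ge0 (vsub p y)); rewrite dotBr {3}/dot.
rewrite -/(dot (vsub p y) (vsub p y)) (dotBr p y (vsub p y)); lra.
Qed.

(** Points outside [K] approach [v], and each is separated from [K] by a unit normal; a cluster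
    point of these normals supports [K] at [v]. The tolerance also bounds the error made in moving
    the separating inequality from the outside point to [v]. *)
Lemma supporting_hyperplane k (K : vec k -> Prop) (v : vec k) :
  closed_set_n K -> convex_n K -> boundary_n K v ->
  exists nu, inward_pointing K v nu.
Proof.
move=> Kcl Kcv Bv; have [B1 B2] := Bv; have k0 := pos_INR k.
have Kne : exists w, K w by have [w [Kw _]] := B1 1 Rlt_0_1; exists w.
have [||nu Hnu] := @bolzano_weierstrass k
    (fun e q => vnorm q = 1 /\ forall w, K w -> dot q v - e <= dot q w) 1.
- by move=> e e' q ee' [q1 H]; split=> // w /H; lra.
- move=> e /B2 [y [Ky vy]]; have [q [q1 H]] := strict_separation Kcl Kcv Kne Ky.
  exists q; split=> [i|]; first by rewrite -q1; exact: coord_le_vnorm.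
  split=> // w /H; have := dot_le_vnorm q (vsub v y).
  by rewrite dotBr q1 -/(vdist v y); lra.
have close e : 0 < e -> exists q, vdist nu q < e /\ vnorm q = 1 /\
    forall w, K w -> dot q v - e <= dot q w.
  move=> e0; have d0 : 0 < e / (INR k + 2) by apply: Rdiv_lt_0_compat; lra.
  have E : (INR k + 2) * (e / (INR k + 2)) = e by field; lra.
  have [q [qp [q1 Hq]]] := Hnu _ d0; exists q; split; last first.
    by split=> // w /Hq; nra.
  rewrite vdistC; apply: (Rle_lt_trans _ ((INR k + 1) * (e / (INR k + 2)))); last nra.
  by apply: vnorm_le_coord => [i|]; [apply: Rlt_le; exact: qp|lra].
exists nu; split=> //; exists (- dot nu v); split; last split; last 1 first.
- apply: Rle_antisym; apply: Rnot_lt_le => L.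
    have [|q [nq [q1 _]]] := close (vnorm nu - 1); first lra.
    by have := vdist_triang nu q (@vzero k); rewrite -!vnorm_vdist0; lra.
  have [|q [nq [q1 _]]] := close (1 - vnorm nu); first lra.
  by have := vdist_triang q nu (@vzero k); rewrite -!vnorm_vdist0 (vdistC q); lra.
- move=> w Kw; apply: Rnot_lt_le => L.
  have N0 := vdist_ge0 w v.
  (* Replacing [nu] by [q] costs at most [e * vdist w v] and the tolerance costs [e]; the total
     stays below the assumed violation. *)
  pose e := - (dot nu w + - dot nu v) / (vdist w v + 2).
  have Ee : e * (vdist w v + 2) = - (dot nu w + - dot nu v) by rewrite /e; field; lra.
  have e0 : 0 < e by apply: Rdiv_lt_0_compat; lra.
  have [q [nq [q1 /(_ w Kw)]]] := close e e0.
  have := dot_le_vnorm (vsub q nu) (vsub w v).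
  rewrite -/(vdist w v) -/(vdist q nu) !dotBl !dotBr (vdistC q); nra.
- lra.
Qed.

(** [dist_bdry] is a choice term, meaningful only if the infimum exists; a segment from [z] to a
    point outside [K] supplies the boundary point needed for that. *)
Lemma dist_bdryP k (K : vec k -> Prop) (z : vec k) :
  K z -> (exists y, ~ K y) ->
  is_glb_n (fun r => exists v, boundary_n K v /\ r = vdist z v) (dist_bdry K z).
Proof.
move=> Kz [y Ky]; apply: epsilon_spec; apply: dist_glb.
by have [v [Bv _]] := segment_meets_boundary Kz Ky; exists v.
Qed.

(** Moving from [w] against [nu] by slightly more than the value of the functional makes it
    negative, hence leaves [K]; the boundary is crossed on the way. Half the assumed gap serves as
    the excess. *)
Lemma dist_bdry_le_supporting k (K : vec k -> Prop) (v nu w : vec k) (c : R) :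
  supporting_affine K v nu c -> K w -> (exists y, ~ K y) ->
  dist_bdry K w <= dot nu w - dot nu v.
Proof.
move=> [pos [nuv nu1]] Kw Kne; apply: Rnot_lt_le => L.
pose e := (dist_bdry K w - (dot nu w - dot nu v)) / 2.
pose s := dot nu w - dot nu v + e.
have e0 : 0 < e by rewrite /e; lra.
have nunu : dot nu nu = 1 by rewrite -vnorm_sqr nu1; lra.
pose y : vec k := fun i => 1 * w i + (- s) * nu i.
have Ky : ~ K y by move=> /pos; rewrite /y dotC dot_linl nunu (dotC w) /s; lra.
have [x [Bx wx]] := segment_meets_boundary Kw Ky.
have : dist_bdry K w <= vdist w x by apply: (proj1 (dist_bdryP Kw Kne)); exists x.
have : vdist w y = Rabs s.
  rewrite /vdist (_ : vsub w y = fun i => s * nu i) ?vnormZ ?nu1; first lra.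
  by apply: functional_extensionality => i; rewrite /vsub /y; lra.
have s0 : 0 <= s by have := pos w Kw; rewrite /s; lra.
have : s < dist_bdry K w by rewrite /s /e; lra.
by rewrite Rabs_pos_eq //; lra.
Qed.

Definition nearest_support k (K : vec k -> Prop) (z v nu : vec k) : Prop :=
  inward_pointing K v nu /\ vnorm nu = 1 /\
  vdist z v = dist_bdry K z /\ dot nu z - dot nu v = dist_bdry K z /\
  forall w, K w -> dist_bdry K w <= dot nu w - dot nu v.

(** At a nearest point any supporting normal works: Cauchy-Schwarz bounds the functional at [z] by
    [vdist z v], which is the distance, and the domination gives the reverse inequality. *)
Lemma nearest_support_exists k (K : vec k -> Prop) (z : vec k) :
  closed_set_n K -> convex_n K -> (exists y, ~ K y) -> K z ->
  exists p : vec k * vec k, nearest_support K z p.1 p.2.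
Proof.
move=> Kcl Kcv Kne Kz.
have [v [Bv zv]] := closest_point (@boundary_closed _ K) (dist_bdryP Kz Kne).
have [nu Inu] := supporting_hyperplane Kcl Kcv Bv.
exists (v, nu); split=> //=; case: Inu => _ [c sup].
have nu1 : vnorm nu = 1 by case: sup => _ [].
split=> //; split=> //; split; last by move=> w Kw; exact: dist_bdry_le_supporting sup Kw Kne.
apply: Rle_antisym; last exact: dist_bdry_le_supporting sup Kz Kne.
by rewrite -dotBr -zv; have := dot_le_vnorm nu (vsub z v); rewrite nu1 Rmult_1_l.
Qed.

(** * Directional derivatives and minima in one variable *)

Lemma derivable_pt_lim_shift (f : R -> R) (c l : R) :
  derivable_pt_lim (fun s => f (c + s)) 0 l -> derivable_pt_lim f c l.
Proof.
move=> df e /df [d Hd]; exists d => h h0 /(Hd h h0).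
by rewrite Rplus_0_l Rplus_0_r.
Qed.

Lemma finite_common_radius n (P : 'I_n -> R -> Prop) :
  (forall i d d', d' <= d -> P i d -> P i d') ->
  (forall i, exists d, 0 < d /\ P i d) -> exists d, 0 < d /\ forall i, P i d.
Proof.
elim: n P => [|n IH] P Pmono PE; first by exists 1; split=> [|[]//]; lra.
have [d [d0 Hd]] := PE ord0.
have [||d' [d'0 Hd']] := IH (fun i => P (lift ord0 i)).
- by move=> i e e'; exact: Pmono.
- by move=> i; exact: PE.
exists (Rmin d d'); split=> [|i]; first exact: Rmin_glb_lt.
case: (unliftP ord0 i) => [j|] ->; first exact: Pmono (Rmin_r _ _) (Hd' j).
exact: Pmono (Rmin_l _ _) Hd.
Qed.

(** The increment is split along a staircase that changes one coordinate at a time; on each step the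
    mean value theorem and continuity of the partial derivative apply. *)
Lemma derivable_pt_lim_direction n (X : vec n -> Prop) (F : vec n -> R)
    (G : 'I_n -> vec n -> R) (x xi : vec n) :
  open_set_n X ->
  (forall i y, X y -> derivable_pt_lim (fun s => F (upd y i s)) 0 (G i y)) ->
  (forall i eps, 0 < eps -> exists del, 0 < del /\
    forall y, X y -> vdist x y < del -> Rabs (G i y - G i x) < eps) ->
  X x ->
  derivable_pt_lim (fun s => F (fun j => x j + s * xi j)) 0
    (vsum (fun i => G i x * xi i)).
Proof.
move=> Xo dF Gc Xx eps eps0.
pose c := vsum (fun i => Rabs (xi i)).
have c0 : 0 <= c by apply: vsum_ge0 => i; exact: Rabs_pos.
have e0 : 0 < eps / (c + 1) by apply: Rdiv_lt_0_compat; lra.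
have Ee : (c + 1) * (eps / (c + 1)) = eps by field; lra.
move: (eps / (c + 1)) e0 Ee => e e0 Ee.
have [||d [d0 Hd]] := @finite_common_radius _ (fun i d =>
    forall y, X y -> vdist x y < d -> Rabs (G i y - G i x) < e).
- by move=> i d d' dd' H y Xy xy; apply: H => //; lra.
- by move=> i; exact: Gc.
have [r [r0 Hr]] := Xo x Xx.
have N0 := vnorm_ge0 xi.
have m0 : 0 < Rmin r d by exact: Rmin_glb_lt.
have del0 : 0 < Rmin r d / (vnorm xi + 1) by apply: Rdiv_lt_0_compat; lra.
have Edel : (vnorm xi + 1) * (Rmin r d / (vnorm xi + 1)) = Rmin r d by field; lra.
exists (mkposreal _ del0) => h h0 /= hdel.
have near q : (forall j, Rabs (q j - x j) <= Rabs (h * xi j)) ->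
    X q /\ forall i, Rabs (G i q - G i x) < e.
  move=> qx; have : vdist q x < Rmin r d.
    apply: (Rle_lt_trans _ (vnorm (fun j => h * xi j))); first exact: vnorm_mono.
    by rewrite vnormZ; have := Rabs_pos h; nra.
  have := Rmin_l r d; have := Rmin_r r d => ? ? qx'.
  have Xq : X q by apply: Hr; lra.
  by split=> // i; apply: Hd => //; rewrite vdistC; lra.
pose p m : vec n := fun j => if (j < m)%N then x j + h * xi j else x j.
have step (i : 'I_n) : Rabs (F (p i.+1) - F (p i) - h * (G i x * xi i)) <= Rabs h * (e * Rabs (xi i)).
  have pS : p i.+1 = upd (p i) i (h * xi i).
    apply: functional_extensionality => j; rewrite /p /upd ltnS leq_eqVlt.
    by rewrite val_eqE; case: (eqVneq j i) => [->|_] //=; rewrite ltnn.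
  have p0 : p i = upd (p i) i 0.
    by apply: functional_extensionality => j; rewrite /upd; case: eqP => // _; lra.
  have ptnear s : Rmin 0 (h * xi i) <= s <= Rmax 0 (h * xi i) ->
      X (upd (p i) i s) /\ Rabs (G i (upd (p i) i s) - G i x) < e.
    move=> s01; have [//|Xq Gq] := near (upd (p i) i s); last by split.
    move=> j; rewrite /upd /p; case: (eqVneq j i) => [->|_].
      rewrite ltnn (_ : x i + s - x i = s); last lra.
      by move: s01; rewrite /Rmin /Rmax; case: Rle_dec; rewrite /Rabs; do 2 case: Rcase_abs; lra.
    case: ltnP => _; first by rewrite (_ : x j + h * xi j - x j = h * xi j); lra.
    by rewrite Rminus_diag Rabs_R0; exact: Rabs_pos.
  (* Subtracting the linear function with slope [G i x] makes the derivative in the mean value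
     theorem the small difference [G i - G i x]. *)
  have [s s01|s [Es s01]] := @MVT_abs (fun s => F (upd (p i) i s) - s * G i x)
      (fun s => G i (upd (p i) i s) - 1 * G i x) 0 (h * xi i).
    apply: derivable_pt_lim_minus.
      apply: derivable_pt_lim_shift.
      rewrite (_ : (fun _ => _) = fun s' => F (upd (upd (p i) i s) i s')).
        by apply: dF; case: (ptnear s s01).
      apply: functional_extensionality => s'; congr F.
      by apply: functional_extensionality => j; rewrite /upd; case: eqP => // _; lra.
    apply: derivable_pt_lim_shift => e' e'0; exists (mkposreal _ Rlt_0_1) => h' h'0 _.
    rewrite (_ : _ - 1 * G i x = 0); first by rewrite Rabs_R0.
    by field.
  have [_ Gs] := ptnear s s01.
  rewrite -p0 -pS in Es.
  rewrite (_ : _ - _ - _ = F (p i.+1) - h * xi i * G i x - (F (p i) - 0 * G i x)); last lra.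
  rewrite Es Rmult_1_l Rminus_0_r Rabs_mult.
  have -> : Rabs h * (e * Rabs (xi i)) = e * (Rabs h * Rabs (xi i)) by lra.
  apply: Rmult_le_compat_r; last lra.
  by apply: Rmult_le_pos; exact: Rabs_pos.
have -> : (fun j => x j + (0 + h) * xi j) = p n.
  by apply: functional_extensionality => j; rewrite /p ltn_ord; lra.
have -> : (fun j => x j + 0 * xi j) = p O.
  by apply: functional_extensionality => j; rewrite /p ltn0; lra.
rewrite -(vsum_telescope n (fun m => F (p m))).
set T := vsum _; set L := vsum _.
have TL : Rabs (T - h * L) <= Rabs h * (e * c).
  rewrite /T /L /c -!vsumZ -vsumB; apply: Rle_trans (Rabs_vsum _) _.
  by apply: vsum_le => i; exact: step.
have ha : 0 < Rabs h by exact: Rabs_pos_lt.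
apply: (Rmult_lt_reg_l (Rabs h)) => //.
rewrite -Rabs_mult (_ : h * (T / h - L) = T - h * L); last by field.
apply: Rle_lt_trans TL _; apply: Rmult_lt_compat_l => //; nra.
Qed.

Lemma min_first_derivative (f : R -> R) (s l r : R) : 0 < r ->
  (forall h, Rabs h < r -> f s <= f (s + h)) -> derivable_pt_lim f s l -> l = 0.
Proof.
move=> r0 fmin df; apply: NNPP => l0.
have [d Hd] := df (Rabs l) (Rabs_pos_lt _ l0).
have d0 := cond_pos d; have m0 : 0 < Rmin d r by exact: Rmin_glb_lt.
have := Rmin_l d r; have := Rmin_r d r => mr md.
have [lneg|lpos] : l < 0 \/ 0 < l by lra.
- pose h := Rmin d r / 2.
  have h0 : 0 < h by rewrite /h; lra.
  have ha : Rabs h < Rmin d r by rewrite Rabs_pos_eq /h; lra.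
  have := Hd h ltac:(lra) ltac:(lra); rewrite (Rabs_left l) // => /Rabs_def2 [H _].
  have : 0 <= (f (s + h) - f s) / h.
    apply: Rmult_le_pos; last by apply: Rlt_le; exact: Rinv_0_lt_compat.
    by have := fmin h ltac:(lra); lra.
  lra.
- pose h := - (Rmin d r / 2).
  have h0 : h < 0 by rewrite /h; lra.
  have ha : Rabs h < Rmin d r by rewrite Rabs_left /h; lra.
  have := Hd h ltac:(lra) ltac:(lra); rewrite (Rabs_pos_eq l); last lra.
  move=> /Rabs_def2 [_ H].
  have : 0 <= (f (s + h) - f s) * - / h.
    apply: Rmult_le_pos; first by have := fmin h ltac:(lra); lra.
    by have := Rinv_lt_0_compat h h0; lra.
  by rewrite /Rdiv in H; lra.
Qed.

(** As [f' 0 = 0], a negative [L] would make [f'] negative just to the right of 0, and the mean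
    value theorem would bring [f] below [f 0]. *)
Lemma min_second_derivative (f f' : R -> R) (L r : R) : 0 < r ->
  (forall s, Rabs s < r -> derivable_pt_lim f s (f' s)) ->
  (forall s, Rabs s < r -> f 0 <= f s) -> derivable_pt_lim f' 0 L -> 0 <= L.
Proof.
move=> r0 df fmin df'; apply: Rnot_lt_le => L0.
have f'0 : f' 0 = 0.
  apply: (@min_first_derivative f 0 _ r) => // [h hr|].
    by rewrite Rplus_0_l; exact: fmin.
  by apply: df; rewrite Rabs_R0.
have [d Hd] := df' (- L) ltac:(lra).
have d0 := cond_pos d; have m0 : 0 < Rmin d r by exact: Rmin_glb_lt.
have := Rmin_l d r; have := Rmin_r d r => mr md.
pose s := Rmin d r / 2.
have s0 : 0 < s by rewrite /s; lra.
have sm : s < Rmin d r by rewrite /s; lra.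
have [c cs|c [Ec [c0 cs]]] := MVT_cor2 f f' 0 s s0.
  by apply: df; rewrite Rabs_pos_eq; lra.
have fs : f 0 <= f s by apply: fmin; rewrite Rabs_pos_eq; lra.
have f'c : 0 <= f' c by apply: Rnot_lt_le => ?; nra.
have := Hd c ltac:(lra) ltac:(rewrite Rabs_pos_eq; lra).
rewrite Rplus_0_l f'0 Rminus_0_r => /Rabs_def2 [H _].
have : 0 <= f' c / c by apply: Rmult_le_pos => //; apply: Rlt_le; exact: Rinv_0_lt_compat.
lra.
Qed.

(** * The trace of a product of nonnegative matrices *)

Lemma quad_n_recl n (A : 'I_n.+1 -> 'I_n.+1 -> R) (s : R) (xi : vec n) :
  quad_n A (vcons s xi) = A ord0 ord0 * s * s
    + s * vsum (fun j : 'I_n => A ord0 (lift ord0 j) * xi j)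
    + s * vsum (fun i : 'I_n => A (lift ord0 i) ord0 * xi i)
    + quad_n (fun i j : 'I_n => A (lift ord0 i) (lift ord0 j)) xi.
Proof.
rewrite /quad_n !vsum_recl !vcons0 -!vsumZ.
have -> : vsum (fun j : 'I_n => A ord0 (lift ord0 j) * s * vcons s xi (lift ord0 j)) =
    vsum (fun j : 'I_n => s * (A ord0 (lift ord0 j) * xi j)).
  by apply: eq_vsum => j; rewrite vconsS; lra.
have -> : vsum (fun i : 'I_n => vsum (fun j : 'I_n.+1 =>
      A (lift ord0 i) j * vcons s xi (lift ord0 i) * vcons s xi j)) =
    vsum (fun i : 'I_n => s * (A (lift ord0 i) ord0 * xi i)) +
    vsum (fun i : 'I_n => vsum (fun j : 'I_n => A (lift ord0 i) (lift ord0 j) * xi i * xi j)).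
  rewrite -vsumD; apply: eq_vsum => i.
  rewrite vsum_recl vcons0 !vconsS; congr (_ + _); first lra.
  by apply: eq_vsum => j; rewrite vconsS.
lra.
Qed.

(* Induction on the dimension: splitting off the rank one matrix
   A_{i0} A_{0j} / A_{00} leaves the Schur complement of A_{00}. *)
Lemma trace_mul_ge0 n (A H : 'I_n -> 'I_n -> R) :
  (forall i j, A i j = A j i) ->
  (forall xi : vec n, (exists i, xi i <> 0) -> 0 < quad_n A xi) ->
  (forall xi, 0 <= quad_n H xi) ->
  0 <= vsum (fun i => vsum (fun j => A i j * H i j)).
Proof.
elim: n A H => [|n IH] A H Asym Apd Hpsd.
  by rewrite /vsum big_ord0; lra.
set a := A ord0 ord0; pose b : vec n := fun i => A (lift ord0 i) ord0.
have b' i : A ord0 (lift ord0 i) = b i by rewrite Asym.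
have a0 : 0 < a.
  have := Apd (vcons 1 (@vzero n)); rewrite quad_n_recl.
  have z0 (F : 'I_n -> R) : (forall i, F i = 0) -> vsum F = 0.
    by move=> F0; rewrite (eq_vsum F0) vsum_const; lra.
  rewrite /quad_n !z0 => [H1|i|i|i]; try by rewrite /vzero; lra.
    suff : 0 < a * 1 * 1 + 1 * 0 + 1 * 0 + 0 by lra.
    by apply: H1; exists ord0; rewrite vcons0; lra.
  by apply: z0 => j; rewrite /vzero; lra.
pose B (i j : 'I_n) := A (lift ord0 i) (lift ord0 j) - b i * b j / a.
have HB : 0 <= vsum (fun i : 'I_n => vsum (fun j : 'I_n => B i j * H (lift ord0 i) (lift ord0 j))).
  apply: IH => [i j|eta [i eta0]|eta].
  - by rewrite /B Asym; lra.
  - pose beta := vsum (fun j => b j * eta j).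
    (* This first entry minimises the form of [A] for fixed [eta], and the minimum is the form of
       the Schur complement [B] at [eta]. *)
    have := Apd (vcons (- beta / a) eta); rewrite quad_n_recl -/a.
    rewrite -/beta (_ : vsum (fun j => A ord0 (lift ord0 j) * eta j) = beta); last first.
      by apply: eq_vsum => j; rewrite b'.
    have -> : quad_n B eta =
        quad_n (fun i j => A (lift ord0 i) (lift ord0 j)) eta - beta * beta / a.
      rewrite /quad_n (_ : beta * beta / a = vsum (fun i => vsum (fun j => b i * b j / a * eta i * eta j))).
        rewrite -vsumB; apply: eq_vsum => i'; rewrite -vsumB; apply: eq_vsum => j.
        by rewrite /B; lra.
      rewrite (@eq_vsum n _ (fun i => beta / a * (b i * eta i))).
        by rewrite vsumZ -/beta; lra.
      move=> i'; rewrite (@eq_vsum n _ (fun j => (b i' * eta i' / a) * (b j * eta j))).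
        by rewrite vsumZ -/beta; lra.
      by move=> j; lra.
    have -> : a * (- beta / a) * (- beta / a) = beta * beta / a by field; lra.
    set Q := quad_n _ _ => /(_ _) HQ.
    have {}HQ : 0 < beta * beta / a + - beta / a * beta + - beta / a * beta + Q.
      by apply: HQ; exists (lift ord0 i); rewrite vconsS.
    by lra.
  - have := Hpsd (vcons 0 eta); rewrite quad_n_recl; lra.
(* The test vector is the first column of [A]; the form of [H] there, divided by [a], is the
   contribution of the rank one part. *)
have := Hpsd (vcons a b); rewrite quad_n_recl => Hw.
have E1 : vsum (fun j : 'I_n => A ord0 (lift ord0 j) * H ord0 (lift ord0 j)) =
    vsum (fun j : 'I_n => H ord0 (lift ord0 j) * b j).
  by apply: eq_vsum => j; rewrite b'; lra.
have E2 : vsum (fun i : 'I_n => vsum (fun j : 'I_n.+1 => A (lift ord0 i) j * H (lift ord0 i) j)) =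
    vsum (fun i : 'I_n => H (lift ord0 i) ord0 * b i)
    + (/ a * quad_n (fun i j : 'I_n => H (lift ord0 i) (lift ord0 j)) b
    + vsum (fun i : 'I_n => vsum (fun j : 'I_n => B i j * H (lift ord0 i) (lift ord0 j)))).
  rewrite /quad_n -vsumZ -!vsumD; apply: eq_vsum => i.
  rewrite vsum_recl -/(b i) -vsumZ -vsumD; congr (_ + _); first lra.
  by apply: eq_vsum => j; rewrite /B; field; lra.
have -> : vsum (fun i => vsum (fun j => A i j * H i j)) =
    / a * (H ord0 ord0 * a * a
      + a * vsum (fun j : 'I_n => H ord0 (lift ord0 j) * b j)
      + a * vsum (fun i : 'I_n => H (lift ord0 i) ord0 * b i)
      + quad_n (fun i j : 'I_n => H (lift ord0 i) (lift ord0 j)) b)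
    + vsum (fun i : 'I_n => vsum (fun j : 'I_n => B i j * H (lift ord0 i) (lift ord0 j))).
  by rewrite !vsum_recl -/a E1 E2; field; lra.
apply: Rplus_le_le_0_compat => //; apply: Rmult_le_pos => //.
by apply: Rlt_le; exact: Rinv_0_lt_compat.
Qed.

(** * Space-time distance, continuity and interior minima *)

Lemma vdist_le_pdist n (x y : vec n) t s : vdist x y <= pdist x t y s.
Proof.
rewrite -{1}(sqrt_pow2 _ (vdist_ge0 x y)); apply: sqrt_le_1_alt.
by have := pow2_ge_0 (t - s); lra.
Qed.

Lemma time_le_pdist n (x y : vec n) t s : Rabs (t - s) <= pdist x t y s.
Proof.
rewrite -sqrt_Rsqr_abs; apply: sqrt_le_1_alt; rewrite Rsqr_pow2.
by have := pow2_ge_0 (vdist x y); lra.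
Qed.

Lemma pdist_le n (x y : vec n) t s : pdist x t y s <= vdist x y + Rabs (t - s).
Proof.
have d0 := vdist_ge0 x y; have a0 := Rabs_pos (t - s).
rewrite -(sqrt_pow2 (vdist x y + Rabs (t - s))); last lra.
by apply: sqrt_le_1_alt; rewrite -(pow2_abs (t - s)); nra.
Qed.

Lemma pdist_same_time n (x y : vec n) t : pdist x t y t = vdist x y.
Proof.
apply: Rle_antisym; last exact: vdist_le_pdist.
by have := pdist_le x y t t; rewrite Rminus_diag Rabs_R0; lra.
Qed.

Lemma pdistC n (x y : vec n) t s : pdist x t y s = pdist y s x t.
Proof. by rewrite /pdist vdistC; congr sqrt; ring. Qed.

Lemma vdist_upd_le n (x : vec n) i s : vdist (upd x i s) x <= (INR n + 1) * Rabs s.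
Proof.
apply: vnorm_le_coord; last exact: Rabs_pos.
move=> j; rewrite /vsub /upd; case: eqP => _.
  by rewrite (_ : x j + s - x j = s); lra.
by rewrite Rminus_diag Rabs_R0; exact: Rabs_pos.
Qed.

Lemma vdist_line n (x xi : vec n) s s' :
  vdist (fun j => x j + s * xi j) (fun j => x j + s' * xi j) = Rabs (s - s') * vnorm xi.
Proof.
rewrite /vdist -vnormZ; congr vnorm; apply: functional_extensionality => j.
by rewrite /vsub; lra.
Qed.

Lemma line0 n (x xi : vec n) : (fun j => x j + 0 * xi j) = x.
Proof. by apply: functional_extensionality => j; lra. Qed.

Lemma upd0 n (x : vec n) i : upd x i 0 = x.
Proof. by apply: functional_extensionality => j; rewrite /upd; case: eqP => // _; lra. Qed.

Lemma cont_on_slice n (X : vec n -> Prop) (f : vec n -> R -> R) x t :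
  cont_on (Omega X) f -> Omega X x t -> forall eps, 0 < eps ->
  exists del, 0 < del /\
    forall y, X y -> vdist x y < del -> Rabs (f y t - f x t) < eps.
Proof.
move=> fc Oxt eps /(fc x t Oxt) [d [d0 Hd]]; exists d; split=> // y Xy xy.
by apply: Hd; [split=> //; case: Oxt | rewrite pdist_same_time].
Qed.

Lemma cont_on_lin n (S : vec n -> R -> Prop) f g a b :
  cont_on S f -> cont_on S g -> cont_on S (fun x t => a * f x t + b * g x t).
Proof.
move=> fc gc x t Sxt eps eps0.
have a0 := Rabs_pos a; have b0 := Rabs_pos b.
pose e := eps / (Rabs a + Rabs b + 1).
have e0 : 0 < e by apply: Rdiv_lt_0_compat; lra.
have Ee : (Rabs a + Rabs b + 1) * e = eps by rewrite /e; field; lra.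
have [d [d0 Hd]] := fc x t Sxt e e0; have [d' [d'0 Hd']] := gc x t Sxt e e0.
exists (Rmin d d'); split=> [|y s Sys xy]; first exact: Rmin_glb_lt.
have := Rmin_l d d'; have := Rmin_r d d' => ? ?.
have := Hd y s Sys ltac:(lra); have := Hd' y s Sys ltac:(lra).
have -> : a * f y s + b * g y s - (a * f x t + b * g x t) =
  a * (f y s - f x t) + b * (g y s - g x t) by lra.
move=> Hg Hf; apply: Rle_lt_trans (Rabs_triang _ _) _; rewrite !Rabs_mult.
have := Rabs_pos (f y s - f x t); have := Rabs_pos (g y s - g x t); nra.
Qed.

Lemma cont_on_vsum n m (S : vec n -> R -> Prop) (f : 'I_m -> vec n -> R -> R) c :
  (forall i, cont_on S (f i)) -> cont_on S (fun x t => vsum (fun i => c i * f i x t)).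
Proof.
elim: m f c => [|m IH] f c fc.
  move=> x t _ eps eps0; exists 1; split=> [|y s _ _]; first lra.
  by rewrite /vsum !big_ord0 Rminus_diag Rabs_R0.
have H := cont_on_lin (c ord0) 1 (fc ord0)
  (IH (fun i => f (lift ord0 i)) (fun i => c (lift ord0 i)) (fun i => fc _)).
move=> x t Sxt eps /(H x t Sxt) [d [d0 Hd]]; exists d; split=> // y s Sys xy.
by have := Hd y s Sys xy; rewrite !Rmult_1_l !vsum_recl.
Qed.

Lemma cont_on_eq n (S : vec n -> R -> Prop) f g :
  (forall x t, S x t -> f x t = g x t) -> cont_on S f -> cont_on S g.
Proof.
move=> fg fc x t Sxt eps /(fc x t Sxt) [d [d0 Hd]]; exists d; split=> // y s Sys xy.
by rewrite -!fg //; exact: Hd.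
Qed.

Lemma pderiv_x_unique n (X : vec n -> Prop) f f' i g g' : open_set_n X ->
  (forall x t, Omega X x t -> f x t = f' x t) ->
  pderiv_x (Omega X) f i g -> pderiv_x (Omega X) f' i g' ->
  forall x t, Omega X x t -> g x t = g' x t.
Proof.
move=> Xo ff' dg dg' x t [Xx t0]; have n0 := pos_INR n.
have [r [r0 Hr]] := Xo x Xx.
pose e := r / (INR n + 1); have e0 : 0 < e by apply: Rdiv_lt_0_compat; lra.
have Ee : (INR n + 1) * e = r by rewrite /e; field; lra.
apply: (uniqueness_limite (fun s => f' (upd x i s) t) 0); last exact: dg'.
apply: (@derivable_pt_lim_locally_ext (fun s => f (upd x i s) t) _ 0 (- e) e); first lra.
  move=> s [se1 se2]; have se : Rabs s < e by apply: Rabs_def1; lra.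
  apply: ff'; split=> //; apply: Hr.
  by have := vdist_upd_le x i s; nra.
exact: dg.
Qed.

(** Smoothness only asserts that some continuous derivatives exist; uniqueness on Omega identifies
    them with the given ones. At second order the functions differentiated agree only on Omega,
    which is why [pderiv_x_unique] is stated for two functions. *)
Lemma smooth_pderiv_cont n (X : vec n -> Prop) psi psix psixx : open_set_n X ->
  smooth_n (Omega X) psi ->
  (forall i, pderiv_x (Omega X) psi i (psix i)) ->
  (forall i j, pderiv_x (Omega X) (psix j) i (psixx i j)) ->
  (forall i, cont_on (Omega X) (psix i)) /\
  (forall i j, cont_on (Omega X) (psixx i j)).
Proof.
move=> Xo /(_ 2%N) /= [_ [_ C2]] dx dxx; split=> [i|i j].
  have [g [dg [gc _]]] := C2 i.
  exact: cont_on_eq (pderiv_x_unique Xo (fun _ _ _ => erefl) dg (dx i)) gc.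
have [g [dg [gc [_ C1]]]] := C2 j; have [h [dh hc]] := C1 i.
have E := pderiv_x_unique Xo (fun _ _ _ => erefl) dg (dx j).
exact: cont_on_eq (pderiv_x_unique Xo E dh (dxx i j)) hc.
Qed.

Lemma derivable_pt_lim_line n (X : vec n -> Prop) f fx x t xi s :
  open_set_n X -> (forall i, pderiv_x (Omega X) f i (fx i)) ->
  (forall i, cont_on (Omega X) (fx i)) ->
  Omega X (fun j => x j + s * xi j) t ->
  derivable_pt_lim (fun s => f (fun j => x j + s * xi j) t) s
    (vsum (fun i => fx i (fun j => x j + s * xi j) t * xi i)).
Proof.
move=> Xo df fxc Os; have [Xs t0] := Os; apply: derivable_pt_lim_shift.
pose F y := f y t.
rewrite (_ : (fun _ => _) = fun s' => F (fun j => (x j + s * xi j) + s' * xi j)).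
  apply: (@derivable_pt_lim_direction n X F (fun i y => fx i y t)) => //.
    by move=> i y Xy; apply: df.
  by move=> i; exact: cont_on_slice.
apply: functional_extensionality => s'; rewrite /F; congr (f _ t).
by apply: functional_extensionality => j; lra.
Qed.

(** Everything is reduced to one variable: the time axis, the coordinate lines, and an arbitrary
    line through [xh] for the Hessian. *)
Lemma interior_min_conditions n (X : vec n -> Prop) f ft fx fxx xh th r :
  open_set_n X -> pderiv_t (Omega X) f ft ->
  (forall i, pderiv_x (Omega X) f i (fx i)) ->
  (forall i, cont_on (Omega X) (fx i)) ->
  (forall i j, pderiv_x (Omega X) (fx j) i (fxx i j)) ->
  (forall i j, cont_on (Omega X) (fxx i j)) ->
  Omega X xh th -> 0 < r ->
  (forall x t, Omega X x t -> pdist x t xh th < r -> f xh th <= f x t) ->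
  ft xh th = 0 /\ (forall i, fx i xh th = 0) /\
  forall xi, 0 <= quad_n (fun i j => fxx i j xh th) xi.
Proof.
move=> Xo dt dx fxc dxx fxxc Oh r0 fmin; have [Xh th0] := Oh.
have [r1 [r10 Hr1]] := Xo xh Xh; have n0 := pos_INR n.
have m0 : 0 < Rmin r r1 by exact: Rmin_glb_lt.
have := Rmin_l r r1; have := Rmin_r r r1 => mr1 mr.
have near y : vdist y xh < Rmin r r1 -> Omega X y th /\ f xh th <= f y th.
  move=> yx; have Oy : Omega X y th by split=> //; apply: Hr1; lra.
  by split=> //; apply: fmin => //; rewrite pdist_same_time; lra.
split; [|split=> [i|xi]].
(* The radius is capped by [th] so that the perturbed time stays positive. *)
- apply: (@min_first_derivative (fun s => f xh s) th _ (Rmin r th)); last exact: dt.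
    exact: Rmin_glb_lt.
  have := Rmin_l r th; have := Rmin_r r th => ? ? h hr.
  apply: fmin.
    by split=> //; have := Rabs_def2 _ _ hr; lra.
  by have := pdist_le xh xh (th + h) th; rewrite vdistxx (_ : th + h - th = h); lra.
- pose e := Rmin r r1 / (INR n + 1).
  have e0 : 0 < e by apply: Rdiv_lt_0_compat; lra.
  have Ee : (INR n + 1) * e = Rmin r r1 by rewrite /e; field; lra.
  apply: (@min_first_derivative (fun s => f (upd xh i s) th) 0 _ e) => //; last exact: dx.
  move=> s se; rewrite Rplus_0_l upd0; apply: (proj2 (near _ _)).
  by have := vdist_upd_le xh i s; nra.
have N0 := vnorm_ge0 xi.
pose e := Rmin r r1 / (vnorm xi + 1).
have e0 : 0 < e by apply: Rdiv_lt_0_compat; lra.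
have Ee : (vnorm xi + 1) * e = Rmin r r1 by rewrite /e; field; lra.
have lnear s : Rabs s < e -> vdist (fun j => xh j + s * xi j) xh < Rmin r r1.
  move=> se; rewrite -{2}(line0 xh xi) vdist_line Rminus_0_r.
  by have := Rabs_pos s; nra.
apply: (@min_second_derivative (fun s => f (fun j => xh j + s * xi j) th)
  (fun s => vsum (fun i => fx i (fun j => xh j + s * xi j) th * xi i)) _ e) => //.
- by move=> s /lnear /near [Os _]; exact: (@derivable_pt_lim_line n X f fx).
- by move=> s /lnear /near [_]; rewrite line0.
have -> : quad_n (fun i j => fxx i j xh th) xi =
    vsum (fun j => xi j * vsum (fun i => fxx i j (fun l => xh l + 0 * xi l) th * xi i)).
  rewrite line0 /quad_n vsum_exchange; apply: eq_vsum => j.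
  by rewrite -vsumZ; apply: eq_vsum => i; lra.
apply: derivable_pt_lim_vsum => j.
rewrite (_ : (fun _ => _) = mult_real_fct (xi j) (fun s => fx j (fun l => xh l + s * xi l) th)).
  apply: derivable_pt_lim_scal; apply: (@derivable_pt_lim_line n X (fx j) (fxx^~ j)) => //.
  by rewrite line0.
by apply: functional_extensionality => s; rewrite /mult_real_fct; lra.
Qed.

(** * Local boundedness *)

(** Turns the locally uniform hypotheses into statements at a single point. *)
Lemma compact_in_point n (S : vec n -> R -> Prop) x t : S x t ->
  compact_in (fun y s => y = x /\ s = t) S.
Proof.
move=> Sxt; split=> [y s Hys|]; last split; last by move=> _ _ [-> ->].
- have d0 : pdist y s x t = 0.
    apply: Rle_antisym; last exact: sqrt_pos.
    by apply: Rnot_lt_le => /Hys [_ [_ [[-> ->]]]]; lra.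
  split.
    apply: vdist_eq0; apply: Rle_antisym; last exact: vdist_ge0.
    by rewrite -d0; exact: vdist_le_pdist.
  have := time_le_pdist y x s t; rewrite d0.
  by rewrite /Rabs; case: Rcase_abs; lra.
- by exists (pdist x t (@vzero n) 0) => _ _ [-> ->]; lra.
Qed.

(** If [f] were unbounded on [C], points with ever larger values would cluster at a point of [C],
    where continuity bounds [f] nearby. *)
Lemma cont_on_loc_bounded n (S : vec n -> R -> Prop) f :
  cont_on S f -> loc_bounded S f.
Proof.
move=> fc C [Ccl [[B CB] CS]]; apply: NNPP => unb; have n0 := pos_INR n.
pose tl (q : vec n.+1) : vec n := fun i => q (lift ord0 i).
(* Coordinate 0 is the time. The condition [1 < e * Rabs f] says that the value exceeds [/ e], in a
   form visibly monotone in [e]. *)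
have [||p Hp] := @bolzano_weierstrass n.+1 (fun e q =>
   C (tl q) (q ord0) /\ 1 < e * Rabs (f (tl q) (q ord0))) B.
- move=> e e' q ee' [Cq eq]; split=> //.
  by have := Rabs_pos (f (tl q) (q ord0)); nra.
- move=> e e0; have [x [t [Cxt fxt]]] : exists x t, C x t /\ / e < Rabs (f x t).
    apply: NNPP => H; apply: unb; exists (/ e) => x t Cxt.
    by apply: Rnot_lt_le => L; apply: H; exists x, t.
  have tlE : tl (vcons t x) = x.
    by apply: functional_extensionality => i; rewrite /tl vconsS.
  exists (vcons t x); rewrite tlE vcons0; split=> [i|]; last first.
    split=> //; have := Rmult_lt_compat_l _ _ _ e0 fxt; rewrite Rinv_r; lra.
  have := CB x t Cxt; have := vdist_le_pdist x (@vzero n) t 0.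
  have := time_le_pdist x (@vzero n) t 0; rewrite Rminus_0_r -vnorm_vdist0.
  case: (unliftP ord0 i) => [j|] ->; rewrite ?vcons0 ?vconsS; last lra.
  by have := coord_le_vnorm x j; lra.
have close e : 0 < e -> exists x t, C x t /\ pdist (tl p) (p ord0) x t < e /\
    1 < e * Rabs (f x t).
  move=> e0; have d0 : 0 < e / (INR n + 3) by apply: Rdiv_lt_0_compat; lra.
  have E : (INR n + 3) * (e / (INR n + 3)) = e by field; lra.
  move: (e / _) d0 E => d d0 E.
  have [q [qp [Cq fq]]] := Hp _ d0; exists (tl q), (q ord0).
  split=> //; split; last first.
    by have := Rabs_pos (f (tl q) (q ord0)); nra.
  rewrite pdistC; apply: Rle_lt_trans (pdist_le _ _ _ _) _.
  have := qp ord0; have : vdist (tl q) (tl p) <= (INR n + 1) * d; last nra.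
  by apply: vnorm_le_coord => [i|]; [exact: Rlt_le (qp _)|lra].
have Cp : C (tl p) (p ord0).
  by apply: Ccl => e /close [x [t [Cxt [pxt _]]]]; exists x, t.
have [d [d0 Hd]] := fc _ _ (CS _ _ Cp) 1 Rlt_0_1.
set M := Rabs (f (tl p) (p ord0)); have M0 : 0 <= M by exact: Rabs_pos.
have e0 : 0 < / (M + 1) by apply: Rinv_0_lt_compat; lra.
have [x [t [Cxt [pxt fxt]]]] := close _ (Rmin_glb_lt _ _ _ d0 e0).
have := Rmin_l d (/ (M + 1)); have := Rmin_r d (/ (M + 1)) => m1 m2.
have Hf := Hd x t (CS _ _ Cxt) ltac:(lra).
have fM : Rabs (f x t) < M + 1.
  by have := Rabs_triang_inv (f x t) (f (tl p) (p ord0)); rewrite -/M; lra.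
have E : / (M + 1) * (M + 1) = 1 by apply: Rinv_l; lra.
have := Rabs_pos (f x t); nra.
Qed.

Lemma loc_bounded_le n (S : vec n -> R -> Prop) f g :
  (forall x t, S x t -> Rabs (f x t) <= g x t) -> loc_bounded S g -> loc_bounded S f.
Proof.
move=> fg gb C CS; have [B HB] := gb C CS; exists B => x t Cxt.
apply: Rle_trans (HB x t Cxt); apply: Rle_trans (Rle_abs _).
by apply: fg; case: CS => _ [_]; apply.
Qed.

Lemma loc_bounded_cst n (S : vec n -> R -> Prop) c : loc_bounded S (fun _ _ => c).
Proof. by move=> C _; exists (Rabs c) => *; lra. Qed.

Lemma loc_boundedD n (S : vec n -> R -> Prop) f g :
  loc_bounded S f -> loc_bounded S g -> loc_bounded S (fun x t => f x t + g x t).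
Proof.
move=> fb gb C CS; have [B HB] := fb C CS; have [B' HB'] := gb C CS.
exists (B + B') => x t Cxt; apply: Rle_trans (Rabs_triang _ _) _.
by have := HB x t Cxt; have := HB' x t Cxt; lra.
Qed.

Lemma loc_boundedM n (S : vec n -> R -> Prop) f g :
  loc_bounded S f -> loc_bounded S g -> loc_bounded S (fun x t => f x t * g x t).
Proof.
move=> fb gb C CS; have [B HB] := fb C CS; have [B' HB'] := gb C CS.
exists (B * B') => x t Cxt; rewrite Rabs_mult.
by apply: Rmult_le_compat; [exact: Rabs_pos|exact: Rabs_pos|exact: HB|exact: HB'].
Qed.

Lemma loc_bounded_abs n (S : vec n -> R -> Prop) f :
  loc_bounded S f -> loc_bounded S (fun x t => Rabs (f x t)).
Proof.
by move=> fb C CS; have [B HB] := fb C CS; exists B => x t /HB; rewrite Rabs_Rabsolu.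
Qed.

Lemma loc_bounded_vsum n m (S : vec n -> R -> Prop) (f : 'I_m -> vec n -> R -> R) :
  (forall i, loc_bounded S (f i)) -> loc_bounded S (fun x t => vsum (fun i => f i x t)).
Proof.
elim: m f => [|m IH] f fb C CS.
  by exists 0 => x t _; rewrite /vsum big_ord0 Rabs_R0; lra.
have [B HB] := loc_boundedD (fb ord0) (IH (fun i => f (lift ord0 i)) (fun i => fb _)) CS.
by exists B => x t /HB; rewrite vsum_recl.
Qed.

Lemma vnorm_le_vsum k (v : vec k) : vnorm v <= vsum (fun i => Rabs (v i)).
Proof.
have [v0|v0] := Req_dec (vnorm v) 0.
  by rewrite v0; apply: vsum_ge0 => i; exact: Rabs_pos.
have vp : 0 < vnorm v by have := vnorm_ge0 v; lra.
apply: (Rmult_le_reg_r (vnorm v)) => //; rewrite vnorm_sqr -vsumZr.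
apply: vsum_le => i; have := coord_le_vnorm v i; have := Rabs_pos (v i).
by rewrite -(Rabs_pos_eq (v i * v i)) ?Rabs_mult; nra.
Qed.

Lemma loc_bounded_vnorm n k (S : vec n -> R -> Prop) (w : vec n -> R -> vec k) :
  (forall c, loc_bounded S (fun x t => w x t c)) ->
  loc_bounded S (fun x t => vnorm (w x t)).
Proof.
move=> wb; apply: (@loc_bounded_le _ _ _ (fun x t => vsum (fun i => Rabs (w x t i)))).
  by move=> x t _; rewrite Rabs_pos_eq; [exact: vnorm_le_vsum|exact: vnorm_ge0].
by apply: loc_bounded_vsum => i; exact: loc_bounded_abs.
Qed.

Lemma loc_bounded_z_comp n k (S : vec n -> R -> Prop) F (w : vec n -> R -> vec k) :
  loc_bounded_z S F -> loc_bounded S (fun x t => vnorm (w x t)) ->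
  loc_bounded S (fun x t => F x t (w x t)).
Proof.
move=> Fb wb C CS; have [r Hr] := wb C CS; have [B HB] := Fb C CS r.
by exists B => x t Cxt; apply: HB => //; apply: Rle_trans (Rle_abs _) (Hr x t Cxt).
Qed.

(* At [z = v] the quotient is [0 / 0 = 0]. *)
Definition diff_quotient k (F : vec k -> R) (z v : vec k) : R :=
  Rabs (F z - F v) / vdist z v.

Lemma diff_quotientE k (F : vec k -> R) z v :
  Rabs (F z - F v) = diff_quotient F z v * vdist z v.
Proof.
have [d0|d0] := Req_dec (vdist z v) 0; last by rewrite /diff_quotient; field.
by rewrite d0 (vdist_eq0 d0) Rminus_diag Rabs_R0; lra.
Qed.

Lemma diff_quotient_ge0 k (F : vec k -> R) z v : 0 <= diff_quotient F z v.
Proof.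
have [d0|d0] := Req_dec (vdist z v) 0.
  by rewrite /diff_quotient (vdist_eq0 d0) Rminus_diag Rabs_R0; lra.
apply: Rmult_le_pos; first exact: Rabs_pos.
by apply: Rlt_le; apply: Rinv_0_lt_compat; have := vdist_ge0 z v; lra.
Qed.

(** The Lipschitz constant bounds the quotient whatever the selections [z] and [v] are, so their
    possible discontinuity is harmless. [Rabs L] is taken because [L] has no prescribed sign. *)
Lemma loc_bounded_diff_quotient n k (S : vec n -> R -> Prop) F (z v : vec n -> R -> vec k) :
  lipschitz_z S F -> loc_bounded S (fun x t => diff_quotient (F x t) (z x t) (v x t)).
Proof.
move=> FL C CS; have [L HL] := FL C CS; exists (Rabs L) => x t Cxt.
rewrite Rabs_pos_eq; last exact: diff_quotient_ge0.
have [d0|d0] := Req_dec (vdist (z x t) (v x t)) 0.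
  by rewrite /diff_quotient (vdist_eq0 d0) Rminus_diag Rabs_R0 /Rdiv Rmult_0_l; exact: Rabs_pos.
have dp : 0 < vdist (z x t) (v x t) by have := vdist_ge0 (z x t) (v x t); lra.
apply: (Rmult_le_reg_r (vdist (z x t) (v x t))) => //; rewrite -diff_quotientE.
apply: Rle_trans (HL x t _ _ Cxt) _; apply: Rmult_le_compat_r; [lra|exact: Rle_abs].
Qed.

(** * Contraction with the normal and its perturbation *)

(** Testing the eigenvector relation against [nu] itself shows that the eigenvalue is the form of
    [A] at the unit vector [nu]. *)
Lemma left_eigvec_unit k (A : 'I_k -> 'I_k -> R) (nu w : vec k) :
  vnorm nu = 1 -> left_eigvec A nu ->
  vsum (fun a => nu a * vsum (fun b => A a b * w b)) = quad_n A nu * dot nu w.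
Proof.
move=> nu1 [_ [lam Hlam]].
have swap (y : vec k) : vsum (fun a => nu a * vsum (fun b => A a b * y b)) = lam * dot nu y.
  rewrite -vsumZ (@eq_vsum k _ (fun a => vsum (fun b => nu a * A a b * y b))).
    rewrite vsum_exchange; apply: eq_vsum => b.
    by rewrite vsumZr Hlam; lra.
  by move=> a; rewrite -vsumZ; apply: eq_vsum => b; lra.
have -> : quad_n A nu = lam * dot nu nu.
  rewrite -swap; apply: eq_vsum => a; rewrite -vsumZ.
  by apply: eq_vsum => b; lra.
by rewrite swap -vnorm_sqr nu1; lra.
Qed.

Lemma dot_perturb_ge k (nu p q e : vec k) (d : R) :
  (forall c, Rabs (nu c) <= 1) -> (forall c, Rabs (p c - q c) <= e c * d) ->
  dot nu q - d * vsum e <= dot nu p.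
Proof.
move=> nu1 pq; rewrite /dot -vsumZ -vsumB; apply: vsum_le => c.
have := Rle_abs (- (nu c * (p c - q c))); rewrite Rabs_Ropp Rabs_mult.
have := Rmult_le_compat _ _ _ _ (Rabs_pos _) (Rabs_pos _) (nu1 c) (pq c); lra.
Qed.

Lemma mx_perturb_ge k (nu w : vec k) (A B Q : 'I_k -> 'I_k -> R) (d : R) :
  (forall c, Rabs (nu c) <= 1) ->
  (forall c b, Rabs (A c b - B c b) <= Q c b * d) ->
  vsum (fun c => nu c * vsum (fun b => B c b * w b))
    - d * vsum (fun c => vsum (fun b => Q c b * Rabs (w b)))
  <= vsum (fun c => nu c * vsum (fun b => A c b * w b)).
Proof.
move=> nu1 AB; apply: dot_perturb_ge => // c.
rewrite -vsumB -vsumZr; apply: Rle_trans (Rabs_vsum _) _; apply: vsum_le => b.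
rewrite -Rmult_minus_distr_r Rabs_mult.
have := Rmult_le_compat_r _ _ _ (Rabs_pos (w b)) (AB c b); lra.
Qed.

(** * The coefficients and the supersolution inequality *)

Unset Implicit Arguments.

Theorem theorem2
  (n k : nat) (X : vec n -> Prop)
  (u ut : vec n -> R -> vec k)
  (ux : 'I_n -> vec n -> R -> vec k)
  (uxx : 'I_n -> 'I_n -> vec n -> R -> vec k)
  (a : 'I_n -> 'I_n -> vec n -> R -> R)
  (phi : vec n -> R -> vec k -> vec k)
  (D : vec n -> R -> vec k -> 'I_k -> 'I_k -> R)
  (M : 'I_n -> vec n -> R -> vec k -> 'I_k -> 'I_k -> R)
  (K : vec k -> Prop)
  (* X open and connected_n *)
  (HXo : open_set_n X) (HXc : connected_n X)
  (* u in C^{2,1}(Omega) with derivatives ut, ux, uxx, and u in C(closure Omega) *)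
  (Hu_c : forall c, cont_on (Omega X) (fun x t => u x t c))
  (Hu_t : forall c, pderiv_t (Omega X) (fun x t => u x t c) (fun x t => ut x t c))
  (Hut_c : forall c, cont_on (Omega X) (fun x t => ut x t c))
  (Hu_x : forall c i, pderiv_x (Omega X) (fun x t => u x t c) i (fun x t => ux i x t c))
  (Hux_c : forall c i, cont_on (Omega X) (fun x t => ux i x t c))
  (Hu_xx : forall c i j,
     pderiv_x (Omega X) (fun x t => ux j x t c) i (fun x t => uxx i j x t c))
  (Huxx_c : forall c i j, cont_on (Omega X) (fun x t => uxx i j x t c))
  (Hu_cl : forall c, cont_on (closure_st (Omega X)) (fun x t => u x t c))
  (* the PDE *)
  (HPDE : forall x t, Omega X x t -> forall c,
     ut x t c =
       vsum (fun b => D x t (u x t) c b *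
               vsum (fun i => vsum (fun j => a i j x t * uxx i j x t b)))
     + vsum (fun i => vsum (fun b => M i x t (u x t) c b * ux i x t b))
     + phi x t (u x t) c)
  (* structural assumptions *)
  (Hphi_lip : forall c, lipschitz_z (Omega X) (fun x t z => phi x t z c))
  (HD_lip : forall c b, lipschitz_z (Omega X) (fun x t z => D x t z c b))
  (HM_lip : forall i c b, lipschitz_z (Omega X) (fun x t z => M i x t z c b))
  (Ha_bd : forall i j, loc_bounded (Omega X) (a i j))
  (HD_bd : forall c b, loc_bounded_z (Omega X) (fun x t z => D x t z c b))
  (HM_bd : forall i c b, loc_bounded_z (Omega X) (fun x t z => M i x t z c b))
  (Ha_sym : forall i j x t, Omega X x t -> a i j x t = a j i x t)
  (Ha_pd : loc_unif_posdef (Omega X) a)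
  (HD_pd : loc_unif_posdef_z (Omega X) D)
  (* K closed convex_n, K <> R^k, compatible with phi, D, M *)
  (HKcl : closed_set_n K) (HKcv : convex_n K) (HKne : exists z, ~ K z)
  (Hcompat : forall x t, Omega X x t -> forall v nu, inward_pointing K v nu ->
     0 <= dot (phi x t v) nu /\ left_eigvec (D x t v) nu /\
     (forall i, left_eigvec (M i x t v) nu))
  (* u takes values in K *)
  (HuK : forall x t, Omega X x t -> K (u x t)) :
  exists (alpha : 'I_n -> 'I_n -> vec n -> R -> R)
         (beta : 'I_n -> vec n -> R -> R) (gamma : vec n -> R -> R),
    (forall i j, loc_bounded (Omega X) (alpha i j)) /\
    (forall i, loc_bounded (Omega X) (beta i)) /\
    loc_bounded (Omega X) gamma /\
    (forall x t, Omega X x t -> 0 <= gamma x t) /\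
    loc_unif_posdef (Omega X) alpha /\
    (forall xh th, Omega X xh th ->
     forall (psi psit : vec n -> R -> R) (psix : 'I_n -> vec n -> R -> R)
            (psixx : 'I_n -> 'I_n -> vec n -> R -> R),
       smooth_n (Omega X) psi ->
       pderiv_t (Omega X) psi psit ->
       (forall i, pderiv_x (Omega X) psi i (psix i)) ->
       (forall i j, pderiv_x (Omega X) (psix j) i (psixx i j)) ->
       psi xh th = dist_bdry K (u xh th) ->
       (exists r, 0 < r /\ forall x t, Omega X x t -> pdist x t xh th < r ->
                    psi x t <= dist_bdry K (u x t)) ->
       psit xh th
       - vsum (fun i => vsum (fun j => alpha i j xh th * psixx i j xh th))
       - vsum (fun i => beta i xh th * psix i xh th)
       + gamma xh th * psi xh th >= 0).
Proof.
have [P HP] : exists P : vec k -> vec k * vec k,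
    forall z, K z -> nearest_support K z (P z).1 (P z).2.
  exists (fun z => epsilon (inhabits (z, z)) (fun p => nearest_support K z p.1 p.2)) => z Kz.
  apply: (epsilon_spec _ (fun p => nearest_support K z p.1 p.2)).
  exact: nearest_support_exists.
pose v x t := (P (u x t)).1; pose nu x t := (P (u x t)).2.
have sup x t : Omega X x t -> nearest_support K (u x t) (v x t) (nu x t).
  by move=> Oxt; apply: HP; exact: HuK.
have ub : loc_bounded (Omega X) (fun x t => vnorm (u x t)).
  by apply: loc_bounded_vnorm => c; exact: cont_on_loc_bounded.
have vb : loc_bounded (Omega X) (fun x t => vnorm (v x t)).
  (* A fixed boundary point [v0] bounds the distance from [u] to [v] by that from [u] to [v0].
     Without boundary points Omega is empty, and the bound is vacuous. *)
  have [[v0 Bv0]|noB] := classic (exists v0, boundary_n K v0); last first.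
    move=> C [_ [_ CS]]; exists 0 => x t /CS Oxt; case: noB; exists (v x t).
    by have [[]] := sup x t Oxt.
  apply: (@loc_bounded_le _ _ _ (fun x t => vnorm (u x t) + (vnorm (u x t) + vnorm v0))).
    move=> x t Oxt; rewrite Rabs_pos_eq; last exact: vnorm_ge0.
    have [_ [_ [uv _]]] := sup x t Oxt.
    have : dist_bdry K (u x t) <= vdist (u x t) v0.
      by apply: (proj1 (dist_bdryP (HuK x t Oxt) HKne)); exists v0.
    have := vdist_triang (v x t) (u x t) (@vzero k).
    have := vdist_triang (u x t) (@vzero k) v0.
    rewrite -!vnorm_vdist0 (vdistC (@vzero k)) -vnorm_vdist0 (vdistC (v x t)); lra.
  by apply: loc_boundedD => //; apply: loc_boundedD => //; exact: loc_bounded_cst.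
have nu_le1 x t c : Omega X x t -> Rabs (nu x t c) <= 1.
  move=> Oxt; have [_ [nu1 _]] := sup x t Oxt.
  by rewrite -nu1; exact: coord_le_vnorm.
have nub c : loc_bounded (Omega X) (fun x t => nu x t c).
  apply: (@loc_bounded_le _ _ _ (fun _ _ => 1)); last exact: loc_bounded_cst.
  by move=> x t; exact: nu_le1.
have quadb (A : vec n -> R -> vec k -> 'I_k -> 'I_k -> R) :
    (forall c b, loc_bounded_z (Omega X) (fun x t z => A x t z c b)) ->
    loc_bounded (Omega X) (fun x t => quad_n (A x t (v x t)) (nu x t)).
  move=> Ab; apply: loc_bounded_vsum => c; apply: loc_bounded_vsum => b.
  apply: loc_boundedM => //; apply: loc_boundedM => //.
  exact: (loc_bounded_z_comp (F := fun x t z => A x t z c b)).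
pose lam x t := quad_n (D x t (v x t)) (nu x t).
pose mu i x t := quad_n (M i x t (v x t)) (nu x t).
pose W x t : vec k := fun b => vsum (fun i => vsum (fun j => a i j x t * uxx i j x t b)).
pose QD x t c b := diff_quotient (fun z => D x t z c b) (u x t) (v x t).
pose QM i x t c b := diff_quotient (fun z => M i x t z c b) (u x t) (v x t).
pose Qphi x t c := diff_quotient (fun z => phi x t z c) (u x t) (v x t).
pose GD x t := vsum (fun c => vsum (fun b => QD x t c b * Rabs (W x t b))).
pose GM i x t := vsum (fun c => vsum (fun b => QM i x t c b * Rabs (ux i x t b))).
pose gamma x t := GD x t + vsum (fun i => GM i x t) + vsum (Qphi x t).
exists (fun i j x t => lam x t * a i j x t), mu, gamma.
split; [|split; [|split; [|split; [|split]]]].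
- by move=> i j; apply: loc_boundedM => //; exact: quadb.
- by move=> i; exact: quadb.
- apply: loc_boundedD; first apply: loc_boundedD.
  + apply: loc_bounded_vsum => c; apply: loc_bounded_vsum => b.
    apply: loc_boundedM.
      exact: (@loc_bounded_diff_quotient n k (Omega X) (fun x t z => D x t z c b) u v).
    apply: loc_bounded_abs; apply: loc_bounded_vsum => i; apply: loc_bounded_vsum => j.
    by apply: loc_boundedM => //; exact: cont_on_loc_bounded.
  + apply: loc_bounded_vsum => i; apply: loc_bounded_vsum => c; apply: loc_bounded_vsum => b.
    apply: loc_boundedM.
      exact: (@loc_bounded_diff_quotient n k (Omega X) (fun x t z => M i x t z c b) u v).
    by apply: loc_bounded_abs; exact: cont_on_loc_bounded.
  + apply: loc_bounded_vsum => c.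
    exact: (@loc_bounded_diff_quotient n k (Omega X) (fun x t z => phi x t z c) u v).
- move=> x t _; apply: Rplus_le_le_0_compat; first apply: Rplus_le_le_0_compat.
  + apply: vsum_ge0 => c; apply: vsum_ge0 => b.
    by apply: Rmult_le_pos; [exact: diff_quotient_ge0|exact: Rabs_pos].
  + apply: vsum_ge0 => i; apply: vsum_ge0 => c; apply: vsum_ge0 => b.
    by apply: Rmult_le_pos; [exact: diff_quotient_ge0|exact: Rabs_pos].
  + by apply: vsum_ge0 => c; exact: diff_quotient_ge0.
(* [D] is evaluated at [v], so its ellipticity constant is taken on a ball whose radius [r] bounds
   [v] over [C]. *)
- move=> C HC; have [la [la0 Hla]] := Ha_pd C HC.
  have [r Hr] := vb C HC; have [lD [lD0 HlD]] := HD_pd C HC r.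
  exists (lD * la); split=> [|x t xi Cxt]; first exact: Rmult_lt_0_compat.
  have Oxt : Omega X x t by case: HC => _ [_]; apply.
  have [_ [nu1 _]] := sup x t Oxt.
  have lamD : lD <= lam x t.
    have := HlD x t (v x t) (nu x t) Cxt (Rle_trans _ _ _ (Rle_abs _) (Hr x t Cxt)).
    by rewrite -vnorm_sqr nu1 -/(lam x t); lra.
  have -> : quad_n (fun i j => lam x t * a i j x t) xi =
      lam x t * quad_n (fun i j => a i j x t) xi.
    rewrite /quad_n -vsumZ; apply: eq_vsum => i; rewrite -vsumZ.
    by apply: eq_vsum => j; lra.
  have := Hla x t xi Cxt; have := dot_ge0 xi.
  move: (dot xi xi) (quad_n _ xi) => q Q q0 HQ.
  have : lD * (la * q) <= lam x t * Q by apply: Rmult_le_compat; nra.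
  lra.
move=> xh th Oh psi psit psix psixx psiS dt dx dxx psih [r [r0 touch]].
have [psixc psixxc] := smooth_pderiv_cont HXo psiS dx dxx.
have [Inu [nu1 [dE [lE lge]]]] := sup xh th Oh.
set nuh := nu xh th in Inu nu1 lE lge; set vh := v xh th in Inu dE lE lge.
set d := dist_bdry K (u xh th) in psih dE lE.
have d0 : 0 <= d by rewrite -dE; exact: vdist_ge0.
have [phi0 [eigD eigM]] := Hcompat xh th Oh vh nuh Inu.
have nuh_le1 c : Rabs (nuh c) <= 1 by exact: nu_le1.
(* Applied to [u] and [psi] this is the affine function of [u] minus [psi], up to the constant
   [dot nuh vh]; applied to their derivatives it gives the derivatives of that difference. *)
pose comb (w : vec k) (s : R) := 1 * vsum (fun c => nuh c * w c) + -1 * s.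
have dcomb (w : R -> vec k) (w' : vec k) (g : R -> R) g' s :
    (forall c, derivable_pt_lim (fun h => w h c) s (w' c)) -> derivable_pt_lim g s g' ->
    derivable_pt_lim (fun h => comb (w h) (g h)) s (comb w' g').
  move=> dw dg; apply: derivable_pt_lim_plus; apply: derivable_pt_lim_scal => //.
  by apply: derivable_pt_lim_vsum => c; apply: derivable_pt_lim_scal.
have ccomb (w : vec n -> R -> vec k) g : (forall c, cont_on (Omega X) (fun x t => w x t c)) ->
    cont_on (Omega X) g -> cont_on (Omega X) (fun x t => comb (w x t) (g x t)).
  move=> wc gc; apply: cont_on_lin => //.
  exact: (@cont_on_vsum _ _ _ (fun c x t => w x t c)).
have [||||||gt [gx gxx]] := @interior_min_conditions n X
    (fun x t => comb (u x t) (psi x t)) (fun x t => comb (ut x t) (psit x t))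
    (fun i x t => comb (ux i x t) (psix i x t))
    (fun i j x t => comb (uxx i j x t) (psixx i j x t)) xh th r HXo _ _ _ _ _ Oh r0.
- by move=> x t Oxt; apply: dcomb => [c|]; [exact: Hu_t|exact: dt].
- by move=> i x t Oxt; apply: (dcomb (fun s => u (upd x i s) t)) => [c|]; [exact: Hu_x|exact: dx].
- by move=> i; apply: ccomb.
- move=> i j x t Oxt; apply: (dcomb (fun s => ux j (upd x i s) t)) => [c|]; [exact: Hu_xx|exact: dxx].
- by move=> i j; apply: ccomb.
(* The value at the touching point is [dot nuh vh]; nearby, [psi] is at most the distance, which is
   at most [dot nuh u - dot nuh vh]. *)
- move=> x t Oxt xr; rewrite /comb psih.
  have := lge (u x t) (HuK x t Oxt); have := touch x t Oxt xr.
  by move: lE; rewrite /dot /d; lra.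
have nut : dot nuh (ut xh th) = psit xh th by move: gt; rewrite /comb /dot; lra.
have nux i : dot nuh (ux i xh th) = psix i xh th by move: (gx i); rewrite /comb /dot; lra.
have [la [la0 Hla]] := Ha_pd _ (compact_in_point Oh).
have trace : 0 <= vsum (fun i => vsum (fun j => a i j xh th * comb (uxx i j xh th) (psixx i j xh th))).
  apply: trace_mul_ge0 => // [i j|xi [i xi0]]; first exact: Ha_sym.
  have := Hla xh th xi (conj erefl erefl); have := sq_le_dot xi i.
  have := Rsqr_pos_lt _ xi0; rewrite /Rsqr; nra.
have lam0 : 0 <= lam xh th.
  have [lD [lD0 HlD]] := HD_pd _ (compact_in_point Oh) (vnorm vh).
  have := HlD xh th vh nuh (conj erefl erefl) (Rle_refl _).
  by rewrite -vnorm_sqr nu1 -/(lam xh th); lra.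
have nuW : dot nuh (W xh th) =
    vsum (fun i => vsum (fun j => a i j xh th * comb (uxx i j xh th) (psixx i j xh th)))
    + vsum (fun i => vsum (fun j => a i j xh th * psixx i j xh th)).
  rewrite -vsumD (@eq_vsum _ _ (fun i => vsum (fun c => vsum (fun j => nuh c * (a i j xh th * uxx i j xh th c))))).
    rewrite vsum_exchange; apply: eq_vsum => c; rewrite -vsumZ.
    by apply: eq_vsum => i; rewrite vsumZ.
  move=> i; rewrite vsum_exchange -vsumD; apply: eq_vsum => j.
  have -> : vsum (fun c => nuh c * (a i j xh th * uxx i j xh th c)) =
      a i j xh th * vsum (fun c => nuh c * uxx i j xh th c).
    by rewrite -vsumZ; apply: eq_vsum => c; lra.
  by rewrite /comb; lra.
(* The eigenvector property holds at [vh] only; passing to [u] costs [d] times the difference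
   quotients weighted by the entries of [W]. *)
have TD : lam xh th * dot nuh (W xh th) - d * GD xh th <=
    vsum (fun c => nuh c * vsum (fun b => D xh th (u xh th) c b * W xh th b)).
  rewrite -(left_eigvec_unit _ nu1 eigD); apply: mx_perturb_ge => // c b.
  by rewrite -dE; exact: Req_le (diff_quotientE (fun z => D xh th z c b) _ _).
rewrite nuW in TD.
have TM i : mu i xh th * psix i xh th - d * GM i xh th <=
    vsum (fun c => nuh c * vsum (fun b => M i xh th (u xh th) c b * ux i xh th b)).
  rewrite -nux -(left_eigvec_unit _ nu1 (eigM i)); apply: mx_perturb_ge => // c b.
  by rewrite -dE; exact: Req_le (diff_quotientE (fun z => M i xh th z c b) _ _).
have {}TM := vsum_le TM; rewrite vsumB vsumZ in TM.
have Tphi : dot nuh (phi xh th vh) - d * vsum (Qphi xh th) <= dot nuh (phi xh th (u xh th)).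
  apply: dot_perturb_ge => // c.
  by rewrite -dE; exact: Req_le (diff_quotientE (fun z => phi xh th z c) _ _).
rewrite dotC in phi0.
have utE : dot nuh (ut xh th) =
    vsum (fun c => nuh c * vsum (fun b => D xh th (u xh th) c b * W xh th b))
    + vsum (fun i => vsum (fun c => nuh c * vsum (fun b => M i xh th (u xh th) c b * ux i xh th b)))
    + dot nuh (phi xh th (u xh th)).
  rewrite vsum_exchange -!vsumD; apply: eq_vsum => c.
  by rewrite (HPDE xh th Oh) /W vsumZ; lra.
have alphaE : vsum (fun i => vsum (fun j => lam xh th * a i j xh th * psixx i j xh th)) =
    lam xh th * vsum (fun i => vsum (fun j => a i j xh th * psixx i j xh th)).
  rewrite -vsumZ; apply: eq_vsum => i; rewrite -vsumZ.
  by apply: eq_vsum => j; lra.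
rewrite alphaE psih /gamma -nut utE.
(* Once [TD], [TM] and [Tphi] are added, the errors cancel against [gamma * d]; what remains is
   [lam] times the trace plus [phi] at [vh] contracted with [nuh], both nonnegative. *)
have := Rmult_le_pos _ _ lam0 trace; lra.
Qed.
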